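(* Let $G$ be a signed eulerian graph and let $\Phi(G)$ denote its flow number. Then: (a) $G$ has no nowhere-zero integer flow if and only if $G$ is unbalanced and $G-e$ is balanced for some edge $e$; (b) $\Phi(G)=2$ if and only if $G$ has an even number of negative edges; (c) $\Phi(G)=3$ if and only if $G$ can be decomposed into three edge-disjoint eulerian subgraphs, each with an odd number of negative edges, that share a common vertex; (d) $\Phi(G)=4$ in all remaining cases (i.e. whenever $G$ has a nowhere-zero integer flow and neither (b) nor (c) applies).
   Context: Graphs are finite and may have loops and multiple edges. A signed graph is a graph $G$ with a signature $\sigma:E(G)\to\{+1,-1\}$; edges with sign $-1$ are negative, others positive. The sign of a set of edges or subgraph is the product of the signs of its edges. A circuit is a connected 2-regular graph; it is balanced if its sign is $+1$ and unbalanced otherwise. A signed graph is balanced if it contains no unbalanced circuit. A graph is eulerian if it is connected and every vertex has even valency. Each edge consists of two half-edges, one at each end. An orientation of a signed graph directs each half-edge toward or away from its end-vertex so that for each positive edge exactly one half-edge points toward its end, while for each negative edge either both half-edges point away from their ends (extroverted) or both point toward them (introverted). For an abelian group $A$, an $A$-flow is a map $\xi:E(G)\to A$ such that at every vertex $v$ the sum of $\xi(e)$ over half-edges at $v$ directed out of $v$ minus the sum of $\xi(e)$ over half-edges at $v$ directed into $v$ equals $0$ (a loop contributes through both of its half-edges). Reversing both half-edges of an edge and negating its value preserves flows, so existence of flows does not depend on the chosen orientation. A flow is nowhere-zero if no edge gets value $0$. A nowhere-zero $k$-flow is a $\mathbb{Z}$-flow with values in $\{\pm1,\dots,\pm(k-1)\}$.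 The flow number $\Phi(G)$ is the least $k$ such that $G$ has a nowhere-zero $k$-flow. *)

(* Defs.v *)
From mathcomp Require Import all_boot all_order all_algebra.

Set Implicit Arguments.
Unset Strict Implicit.
Unset Printing Implicit Defensive.

Import GRing.Theory Num.Theory.
Local Open Scope ring_scope.

(* The two half-edges of [e] are the pairs [(e, true)] and [(e, false)];
   [endv h] is the end-vertex of the half-edge [h], so that [e] is a loop
   when [endv (e, true) = endv (e, false)].                               *)
Record sgraph : Type := SGraph {
  vertex : finType;
  edge : finType;
  endv : edge * bool -> vertex;
  negative : pred edge
}.

Arguments endv {s}.
Arguments negative {s}.

Definition sigma (G : sgraph) (e : edge G) : int := (-1) ^+ negative e.

Record subgraph (G : sgraph) : Type := Subgraph {
  vset : {set vertex G};
  eset : {set edge G};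
  endv_vset : forall (e : edge G) (b : bool), e \in eset -> endv (e, b) \in vset
}.

Definition whole (G : sgraph) : subgraph G :=
  @Subgraph G [set: vertex G] [set: edge G] (fun _ _ _ => in_setT _).

Definition delete_edge (G : sgraph) (e : edge G) : subgraph G :=
  @Subgraph G [set: vertex G] [set~ e] (fun _ _ _ => in_setT _).

Definition is_subgraph (G : sgraph) (H K : subgraph G) : Prop :=
  vset H \subset vset K /\ eset H \subset eset K.

Definition adjacent (G : sgraph) (H : subgraph G) : rel (vertex G) :=
  fun x y => [exists e in eset H, exists b : bool,
    (endv (e, b) == x) && (endv (e, ~~ b) == y)].

(* A connected graph is nonempty. *)
Definition connected (G : sgraph) (H : subgraph G) : Prop :=
  vset H != set0 /\
  {in vset H &, forall x y, connect (adjacent H) x y}.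

(* Counting half-edges makes a loop contribute 2. *)
Definition valency (G : sgraph) (H : subgraph G) (v : vertex G) : nat :=
  #|[set h : edge G * bool | (h.1 \in eset H) && (endv h == v)]|.

Definition circuit (G : sgraph) (C : subgraph G) : Prop :=
  connected C /\ {in vset C, forall v, valency C v = 2%N}.

Definition sign (G : sgraph) (H : subgraph G) : int :=
  \prod_(e in eset H) sigma e.

Definition unbalanced_circuit (G : sgraph) (C : subgraph G) : Prop :=
  circuit C /\ sign C = -1.

Definition balanced (G : sgraph) (H : subgraph G) : Prop :=
  ~ exists C : subgraph G, is_subgraph C H /\ unbalanced_circuit C.

Definition eulerian (G : sgraph) (H : subgraph G) : Prop :=
  connected H /\ {in vset H, forall v, ~~ odd (valency H v)}.

Definition num_negative (G : sgraph) (H : subgraph G) : nat :=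
  #|[set e in eset H | negative e]|.

(* [o h] means that the half-edge [h] is directed out of its end-vertex. *)
Definition is_orientation (G : sgraph) (o : edge G * bool -> bool) : Prop :=
  forall e : edge G,
    if negative e then o (e, true) = o (e, false)
    else o (e, true) = ~~ o (e, false).

Definition is_flow (A : zmodType) (G : sgraph)
    (o : edge G * bool -> bool) (xi : edge G -> A) : Prop :=
  forall v : vertex G,
    \sum_(h : edge G * bool | (endv h == v) && o h) xi h.1
    - \sum_(h : edge G * bool | (endv h == v) && ~~ o h) xi h.1 = 0.

Definition has_nz_flow (A : zmodType) (G : sgraph) : Prop :=
  exists (o : edge G * bool -> bool) (xi : edge G -> A),
    [/\ is_orientation o, is_flow o xi & forall e, xi e != 0].

Definition has_nz_kflow (G : sgraph) (k : nat) : Prop :=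
  exists (o : edge G * bool -> bool) (xi : edge G -> int),
    [/\ is_orientation o, is_flow o xi
      & forall e, xi e != 0 /\ `|xi e| < k%:Z].

(* [flow_number G k] is the relation "Phi(G) = k"; no [k] satisfies it when G
   has no nowhere-zero integer flow.  As usual for k-flows, k ranges over
   k >= 2; this only matters for edgeless graphs, which get flow number 2. *)
Definition flow_number (G : sgraph) (k : nat) : Prop :=
  [/\ (2 <= k)%N, has_nz_kflow G k
    & forall j : nat, (2 <= j)%N -> has_nz_kflow G j -> (k <= j)%N].

Definition three_odd_eulerian_decomposition (G : sgraph) : Prop :=
  exists H : 'I_3 -> subgraph G,
    [/\ forall i, eulerian (H i) /\ odd (num_negative (H i)),
        forall i j, i != j -> [disjoint eset (H i) & eset (H j)],
        \bigcup_i eset (H i) = [set: edge G]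
      & exists v : vertex G, forall i, v \in vset (H i)].

(* Main.v *)
Require Import Defs.
From mathcomp Require Import all_boot all_order all_algebra.
From mathcomp Require Import boolp.
From mathcomp Require Import zify ring.

(** Reading the two halves of an edge separately, an orientation [g] of a signed
    graph is a [bool]-valued function on half-edges whose signature decides
    whether the two values at an edge agree, and [excess] at [v] is the net
    outflow of the flow with all values 1. An Euler tour traversed with
    alternating signs gives an orientation with excess 0 except for [0] or [2]
    at its root [v], according to the parity of the number of negative edges;
    this settles (b).

    Assume now that this number is odd. Consider walks from [v] back to [v] that
    alternate in sign and have the sign [-] at both ends. If such a walk exists, a
    shortest one uses each half-edge at most once, hence each edge at most twice,
    and adding it to the orientation gives a nowhere-zero 4-flow. Otherwise every
    reachable vertex is reached with one sign only, and counting the excess over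
    the set [X] of reachable vertices shows that either all edges but one become
    positive after switching, so that this edge has flow value 0, or [X] is balanced
    and bounded by a 2-edge-cut; then [X] is replaced by a single edge.

    A nowhere-zero 3-flow, with its edges of value [+-2] reversed, is an orientation
    whose excesses are multiples of 6. One has to find an orientation with excess 6
    at one vertex and 0 elsewhere: it splits into three odd closed trails at that
    vertex, and what is left over can be absorbed. Passing to the odd side of a
    2-edge-cut, assume there is none. Start again from an Euler orientation with
    excess 2 at [v]; flipping an alternating trail (edges used once) that returns to
    [v] with sign [-] raises the excess to 6. If there is no such trail, let [X] be
    the set of vertices reached with exactly one sign. A blossom argument shows that
    each component of the vertices reached with both signs is entered through one
    fixed edge, and counting shows that [X] is balanced with exactly four boundary
    edges. Subsets of [X] with at most four boundary edges then carry an even share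
    of the total excess (in units of 6). If every vertex lay in such a set,
    uncrossing would merge these sets into a partition of the vertices into even
    parts, against the oddness of the total. *)

Set Implicit Arguments.
Unset Strict Implicit.
Unset Printing Implicit Defensive.

Import Order.TTheory GRing.Theory Num.Theory.
Local Open Scope ring_scope.

(** * Signs and longest sequences *)

Definition sg (b : bool) : int := if b then 1 else -1.

Lemma sgN b : sg (~~ b) = - sg b. Proof. by case: b. Qed.
Lemma sgM b : sg b * sg b = 1. Proof. by case: b. Qed.
(** The root of an oriented Euler tour has excess [sg b1 + sg b2], one of -2, 0, 2; its residue
    modulo 4 decides whether it vanishes. *)
Lemma sg_add_eq0 b1 b2 (S : int) : (4 %| S)%Z -> (4 %| sg b1 + sg b2 - S)%Z ->
  sg b1 + sg b2 = 0.
Proof. by case: b1; case: b2; rewrite /sg; lia. Qed.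

Lemma sg_add_neq0 b1 b2 (S : int) : ~~ (4 %| S)%Z -> (4 %| sg b1 + sg b2 - S)%Z ->
  b2 = b1.
Proof. by case: b1; case: b2; rewrite /sg; lia. Qed.

Lemma exists_longest (T : Type) (P : seq T -> Prop) (n : nat) (p0 : seq T) :
  P p0 -> (forall p, P p -> (size p <= n)%N) ->
  exists p, P p /\ forall q, P q -> (size q <= size p)%N.
Proof.
move=> P0 bnd; have [k] := ubnP (n - size p0)%N.
elim: k p0 P0 => // k IH p0 P0 lek.
have [[q [Pq lt]]|H] := pselect (exists q, P q /\ (size p0 < size q)%N).
  apply: (IH q Pq); have := bnd _ Pq; lia.
exists p0; split=> // q Pq; rewrite leqNgt; apply/negP => lt.
by apply: H; exists q.
Qed.

(** * Walks in a state space *)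

Section Walks.
Variables (H : finType) (St : eqType) (dep nx : H -> St) (F : {set H}).

(** The states are vertices for Euler tours, and pairs of a vertex and a sign for alternating
    walks. *)
Fixpoint walk (x : St) (p : seq H) : bool :=
  if p is h :: p' then [&& h \in F, dep h == x & walk (nx h) p'] else true.

Definition endpoint (x : St) (p : seq H) : St := last x (map nx p).

Lemma walk_cat x p q : walk x (p ++ q) = walk x p && walk (endpoint x p) q.
Proof. by elim: p x => //= h p IH x; rewrite IH !andbA. Qed.

Lemma fin_cat x p q : endpoint x (p ++ q) = endpoint (endpoint x p) q.
Proof. by rewrite /endpoint map_cat last_cat. Qed.

Lemma walk_sub x p : walk x p -> {subset p <= F}.
Proof.
elim: p x => //= h p IH x /and3P[hF _ /IH sub] k.
by rewrite inE => /orP[/eqP->//|/sub].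
Qed.

Lemma walk_rcons x p h :
  walk x (rcons p h) = [&& walk x p, h \in F & dep h == endpoint x p].
Proof. by rewrite -cats1 walk_cat /= andbT. Qed.

Lemma fin_rcons x p h : endpoint x (rcons p h) = nx h.
Proof. by rewrite -cats1 fin_cat. Qed.

(** With [phi] the indicator of a vertex this counts degrees modulo 2 along a walk; with a signed
    indicator it gives the excess of an alternating walk. *)
Lemma walk_telescope (phi : St -> int) x p : walk x p ->
  \sum_(h <- p) (phi (nx h) - phi (dep h)) = phi (endpoint x p) - phi x.
Proof.
elim: p x => [|h p IH] x /=; first by rewrite big_nil subrr.
move=> /and3P[_ /eqP<- /IH wp]; rewrite big_cons wp /endpoint /=; ring.
Qed.

(** Both occurrences of a repeated half-edge depart from the same state, so the part between them
    can be cut out. *)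
Lemma walk_uniq x p : walk x p ->
  exists q, [/\ walk x q, endpoint x q = endpoint x p, {subset q <= p} & uniq q].
Proof.
have [n] := ubnP (size p); elim: n p => // n IH p len wp.
have [up|nup] := boolP (uniq p); first by exists p; split.
have [h [p1 [p2 [p3 def_p]]]] :
    exists h p1 p2 p3, p = p1 ++ h :: p2 ++ h :: p3.
  elim: p nup {len wp} => //= h p IHp; rewrite negb_and negbK.
  move=> /orP[/splitPr[p2 p3]|/IHp[k [p1 [p2 [p3 ->]]]]].
    by exists h, [::], p2, p3.
  by exists k, (h :: p1), p2, p3.
have [||q [wq fq sq uq]] := IH (p1 ++ h :: p3).
- by move: len; rewrite def_p !size_cat /= size_cat /=; lia.
- move: wp; rewrite def_p !walk_cat /= walk_cat /=.
  by case/andP => -> /and4P[-> -> _ /and3P[_ _ ->]].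
exists q; split=> //.
  by rewrite fq def_p !fin_cat /endpoint /= map_cat last_cat.
move=> k /sq; rewrite def_p !mem_cat !inE mem_cat inE.
by case/orP=> [->//|/orP[->|->]]; rewrite !orbT.
Qed.
End Walks.

(** * Half-edges, excess and compatible orientations *)

Section HalfEdges.
Variables (H V : finType) (nu : H -> V).
Implicit Types (F S : {set H}) (f : H -> int) (g : H -> bool) (v w : V).
Implicit Types (io : H -> H) (p q : seq H) (h k : H).

(* [F] is the set of half-edges of a graph, [io] exchanges the two halves of an edge
   and [nu] gives the end-vertex. The signature is not stored: it is carried by a
   reference orientation, up to [compat]. *)
Definition wf (io : H -> H) (F : {set H}) : Prop :=
  forall h, h \in F -> [/\ io h \in F, io h != h & io (io h) = h].

(** Connectivity is tested on vertex sets that no edge leaves, which avoids paths and ignores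
    isolated vertices. *)
Definition connected_halves (io : H -> H) (F : {set H}) : Prop :=
  forall Y : {set V}, (forall h, h \in F -> nu h \in Y -> nu (io h) \in Y) ->
  (exists2 h, h \in F & nu h \in Y) -> forall h, h \in F -> nu h \in Y.

Definition halves (F : {set H}) (v : V) : {set H} := [set h in F | nu h == v].

Definition even_deg (F : {set H}) : Prop := forall v, ~~ odd #|halves F v|.

Definition excess (F : {set H}) (f : H -> int) (v : V) : int :=
  \sum_(h in F | nu h == v) f h.

(** [g] and [g'] orient the same signed graph: they differ by the reversal of whole edges. *)
Definition compat (io : H -> H) (F : {set H}) (g g' : H -> bool) : Prop :=
  forall h, h \in F -> g (io h) (+) g' (io h) = g h (+) g' h.

Definition edges (io : H -> H) (p : seq H) : seq H := p ++ map io p.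

Definition simple (io : H -> H) (p : seq H) : bool := uniq (edges io p).

Lemma compat_sym io F g g' : compat io F g g' -> compat io F g' g.
Proof. by move=> C h hF; rewrite addbC C // addbC. Qed.

Lemma compat_trans io F g1 g2 g3 :
  compat io F g1 g2 -> compat io F g2 g3 -> compat io F g1 g3.
Proof.
move=> C1 C2 h hF; have := C1 h hF; have := C2 h hF.
by case: (g1 h); case: (g2 h); case: (g3 h); case: (g1 (io h));
   case: (g2 (io h)); case: (g3 (io h)).
Qed.

Lemma excessD F f1 f2 v : excess F (fun h => f1 h + f2 h) v = excess F f1 v + excess F f2 v.
Proof. exact: big_split. Qed.

Lemma excessZ F c f v : excess F (fun h => c * f h) v = c * excess F f v.
Proof. by rewrite /excess mulr_sumr. Qed.

Lemma eq_excess F f1 f2 v : {in F, f1 =1 f2} -> excess F f1 v = excess F f2 v.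
Proof. by move=> E; apply: eq_bigr => h /andP[hF _]; apply: E. Qed.

Lemma excessU F1 F2 f v : [disjoint F1 & F2] ->
  excess (F1 :|: F2) f v = excess F1 f v + excess F2 f v.
Proof.
move=> D; rewrite /excess !big_mkcondr -bigU //=.
by apply: eq_bigl => h; rewrite !inE.
Qed.

Lemma sum_excess F f (Y : {set V}) :
  \sum_(h in F | nu h \in Y) f h = \sum_(v in Y) excess F f v.
Proof.
rewrite (partition_big nu (mem Y)) /=; last by move=> h /andP[].
apply: eq_bigr => v vY; apply: eq_bigl => h.
by case: eqP => [->|]; rewrite ?vY ?andbT ?andbF.
Qed.

Lemma sum_excess_all F f : \sum_(h in F) f h = \sum_v excess F f v.
Proof.
transitivity (\sum_(h in F | nu h \in [set: V]) f h).
  by apply: eq_bigl => h; rewrite inE andbT.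
by rewrite sum_excess; apply: eq_bigl => v; rewrite inE.
Qed.

Lemma sum_sg_parity S g : exists k : int,
  \sum_(h in S) sg (g h) = #|S|%:Z + 2 * k.
Proof.
exists (\sum_(h in S) - (~~ g h)%:Z).
rewrite mulr_sumr -[#|S|%:Z]natz -[_%:R]/(1 *+ _) -sumr_const -big_split /=.
by apply: eq_bigr => h _; case: (g h).
Qed.

Section Fixed.
Variables (io : H -> H) (F : {set H}).
Hypothesis wfF : wf io F.

Lemma io_in h : h \in F -> io h \in F. Proof. by case/wfF. Qed.
Lemma ioK h : h \in F -> io (io h) = h. Proof. by case/wfF. Qed.
Lemma io_neq h : h \in F -> io h != h. Proof. by case/wfF. Qed.

Lemma sum_io (P : pred H) (f : H -> int) :
  \sum_(h in F | P h) f h = \sum_(h in F | P (io h)) f (io h).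
Proof.
rewrite (reindex_onto io io) /=; last by move=> h /andP[/ioK].
apply: eq_bigl => h; apply/andP/andP.
  by case=> /andP[iF Ph] /eqP E; rewrite -E io_in // E.
by case=> hF Ph; rewrite io_in // ioK // eqxx.
Qed.

(** [io] has no fixed point on [F], so [S] is exhausted by removing pairs [h], [io h]. *)
Lemma even_closed (S : {set H}) : S \subset F ->
  (forall h, h \in S -> io h \in S) -> ~~ odd #|S|.
Proof.
have [n] := ubnP #|S|; elim: n S => // n IH S lt sub cl.
have [->|[h hS]] := set_0Vmem S; first by rewrite cards0.
have hF : h \in F by apply: (subsetP sub).
have ihS := cl _ hS; have nh := io_neq hF.
have E : #|S| = #|S :\ h :\ io h|.+2.
  by rewrite (cardsD1 h S) hS (cardsD1 (io h) (S :\ h)) !inE nh ihS.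
rewrite E /= negbK; apply: IH.
- by move: lt; rewrite E; lia.
- by apply/subsetP => k; rewrite !inE => /and3P[_ _ /(subsetP sub)].
move=> k; rewrite !inE => /and3P[k1 k2 kS]; have kF := subsetP sub _ kS.
rewrite cl // andbT; apply/andP; split.
  by apply: contra k2 => /eqP /(congr1 io); rewrite !ioK // => ->.
by apply: contra k1 => /eqP <-; rewrite ioK.
Qed.

Lemma mem_edges p h : {subset p <= F} -> h \in F ->
  (h \in edges io p) = (h \in p) || (io h \in p).
Proof.
move=> sub hF; rewrite mem_cat; congr (_ || _).
apply/mapP/idP => [[k kp ->]|ip]; first by rewrite ioK ?sub.
by exists (io h); rewrite ?ioK.
Qed.

Lemma edges_sub p : {subset p <= F} -> {subset edges io p <= F}.
Proof.
move=> sub h; rewrite mem_cat => /orP[/sub//|/mapP[k /sub kF ->]].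
exact: io_in.
Qed.

Lemma edges_io p h : {subset p <= F} -> h \in F ->
  (io h \in edges io p) = (h \in edges io p).
Proof.
by move=> sub hF; rewrite !mem_edges ?io_in // ioK // orbC.
Qed.

Lemma edges_cat p q : perm_eq (edges io (p ++ q)) (edges io p ++ edges io q).
Proof.
rewrite /edges map_cat -!catA perm_cat2l !catA perm_cat2r.
by rewrite perm_catC.
Qed.

Lemma simple_cat p q : {subset p <= F} -> {subset q <= F} ->
  simple io (p ++ q) =
  [&& simple io p, simple io q & ~~ has (mem (edges io p)) q].
Proof.
move=> sp sq; rewrite /simple (perm_uniq (edges_cat p q)) cat_uniq.
congr (_ && _); rewrite andbC; congr (_ && ~~ _).
rewrite has_cat; suff -> : has (mem (edges io p)) (map io q) =
  has (mem (edges io p)) q by rewrite orbb.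
rewrite has_map; apply: eq_in_has => h hq /=; exact: edges_io (sq _ hq).
Qed.

Lemma simple1 h : h \in F -> simple io [:: h].
Proof. by move=> hF; rewrite /simple /= andbT inE eq_sym io_neq. Qed.

Lemma simple_size p : simple io p -> (size p <= #|H|)%N.
Proof.
rewrite /simple cat_uniq => /andP[up _].
by rewrite -(card_uniqP up) max_card.
Qed.

Definition eset_of (p : seq H) : {set H} := [set h in edges io p].

Lemma sum_edges p (P : pred H) (f : H -> int) : simple io p ->
  \sum_(h in eset_of p | P h) f h =
  \sum_(h <- p) ((if P h then f h else 0) + (if P (io h) then f (io h) else 0)).
Proof.
move=> sp; transitivity (\sum_(h <- edges io p) (if P h then f h else 0)).
  by rewrite big_mkcondr big_uniq //=; apply: eq_bigl => h; rewrite inE.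
by rewrite big_cat big_map big_split.
Qed.

Definition rev_walk (p : seq H) : seq H := rev (map io p).

Lemma simple_rev p : {subset p <= F} -> simple io (rev_walk p) = simple io p.
Proof.
move=> sp; apply: perm_uniq; rewrite /edges /rev_walk map_rev -map_comp.
have -> : map (io \o io) p = p by apply: map_id_in => h /sp /ioK.
by rewrite perm_catC; apply: perm_cat; rewrite perm_rev.
Qed.

Lemma mem_rev_walk p h : {subset p <= F} -> h \in F ->
  (h \in rev_walk p) = (io h \in p).
Proof.
move=> sp hF; rewrite mem_rev; apply/mapP/idP => [[k kp ->]|ip].
  by rewrite ioK ?sp.
by exists (io h); rewrite ?ioK.
Qed.

Lemma rev_walk_sub p : {subset p <= F} -> {subset rev_walk p <= F}.
Proof. by move=> sp h; rewrite mem_rev => /mapP[k /sp kF ->]; apply: io_in. Qed.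

End Fixed.
End HalfEdges.

(** * Euler tours *)

Section Euler.
Variables (H V : finType) (nu : H -> V) (io : H -> H) (F : {set H}).
Hypothesis wfF : wf io F.
Implicit Types (g : H -> bool) (u v w : V) (p q : seq H) (h k : H).

Notation vwalk := (walk nu (nu \o io) F).
Notation vfin := (endpoint (nu \o io)).

Lemma simple_rcons p h : {subset p <= F} -> h \in F ->
  simple io (rcons p h) = simple io p && (h \notin edges io p).
Proof.
move=> sp hF; rewrite -cats1 (simple_cat wfF) ?(simple1 wfF) //=.
  by rewrite orbF.
by move=> k; rewrite inE => /eqP->.
Qed.

Lemma eset_of_sub p : {subset p <= F} -> eset_of io p \subset F.
Proof. by move=> sp; apply/subsetP => h; rewrite inE => /(edges_sub wfF sp). Qed.

Lemma card_halves (S : {set H}) w :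
  #|halves nu S w|%:Z = \sum_(h in S | nu h == w) 1.
Proof.
rewrite sumr_const -[LHS]natz; congr (_ *+ _).
by apply: eq_card => h; rewrite !inE.
Qed.

(** A step of the walk adds 1 at each end of its edge, which telescopes modulo 2; hence only the two
    ends of an open trail have odd degree. *)
Lemma card_halves_walk u p w : vwalk u p -> simple io p ->
  exists k : int, #|halves nu (eset_of io p) w|%:Z =
    (vfin u p == w)%:Z - (u == w)%:Z + 2 * k.
Proof.
move=> wp sp; exists (\sum_(h <- p) (nu h == w)%:Z).
rewrite card_halves sum_edges // mulr_sumr.
rewrite -(walk_telescope (fun x => (x == w)%:Z) wp) -big_split /=.
by apply: eq_bigr => h _; case: eqP; case: eqP.
Qed.

Lemma exists_unused p w : {subset p <= F} ->
  #|halves nu (eset_of io p) w| != #|halves nu F w| ->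
  exists h, [/\ h \in F, nu h = w & h \notin edges io p].
Proof.
move=> sp; have sub : halves nu (eset_of io p) w \subset halves nu F w.
  apply/subsetP => h; rewrite !inE => /andP[/(edges_sub wfF sp)-> ->]//.
rewrite (subset_leqif_cards sub) => /eqP ne.
have /subsetPn[h] : ~~ (halves nu F w \subset halves nu (eset_of io p) w).
  by apply/negP => sub'; apply/ne/eqP; rewrite eqEsubset sub.
rewrite !inE => /andP[hF /eqP nh]; rewrite nh eqxx andbT => hp.
by exists h.
Qed.

Lemma vwalk_split u p k : vwalk u p -> k \in edges io p ->
  exists p1 p2, p = p1 ++ p2 /\ vfin u p1 = nu k.
Proof.
move=> wp kp; have sp := walk_sub wp; have kF := edges_sub wfF sp kp.
move: kp; rewrite (mem_edges wfF) // => /orP[] /splitPr kp; case: kp wp sp.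
  move=> p1 p2; rewrite walk_cat => /andP[_ /and3P[_ /eqP E _]] _.
  by exists p1, (k :: p2).
move=> p1 p2 _ _; exists (rcons p1 (io k)), p2; split; first by rewrite cat_rcons.
by rewrite fin_rcons /= (ioK wfF).
Qed.

Lemma simple_catC p q : simple io (p ++ q) = simple io (q ++ p).
Proof.
apply: perm_uniq; apply: perm_cat; first by rewrite perm_catC.
by rewrite !map_cat perm_catC.
Qed.

Lemma eset_of_catC p q : eset_of io (p ++ q) = eset_of io (q ++ p).
Proof.
apply/setP => h; rewrite !inE /edges !map_cat !mem_cat.
by do 4!case: (_ \in _).
Qed.

(** The signs are chosen along the trail: the first half of an edge is prescribed, the other half is
    forced by the signature, and the next edge starts with the opposite sign. Contributions at inner
    vertices cancel; [b] and [b'] remain at the two ends. *)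
Lemma orient_walk (g0 : H -> bool) u p b : vwalk u p -> simple io p ->
  exists g b', (forall h, h \in p -> g (io h) (+) g0 (io h) = g h (+) g0 h) /\
  forall w, \sum_(h <- p) ((if nu h == w then sg (g h) else 0) +
     (if nu (io h) == w then sg (g (io h)) else 0)) =
   (if u == w then sg b else 0) + (if vfin u p == w then sg b' else 0).
Proof.
elim: p u b => [|h p IH] u b /=.
  (* An empty walk has one vertex as both ends, where opposite signs cancel. *)
  exists g0, (~~ b); split=> // w; rewrite big_nil /endpoint /= sgN.
  by case: eqP => // _; rewrite ?subrr ?addr0.
move=> /and3P[hF /eqP nh wp] shp.
have sp := walk_sub wp.
have sph : {subset [:: h] <= F} by move=> k; rewrite inE => /eqP->.
move: shp; rewrite -cat1s (simple_cat wfF) // => /and3P[_ sp' dis].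
(* [c] is the value at [io h] that compatibility with [g0] forces once [h] gets [b]. *)
pose c := b (+) g0 h (+) g0 (io h).
have [g [b' [cg sumg]]] := IH _ (~~ c) wp sp'.
pose g1 k := if k == h then b else if k == io h then c else g k.
have g1E k : k \in p -> g1 k = g k /\ g1 (io k) = g (io k).
  move=> kp; move/hasPn/(_ k kp): dis; rewrite /= !inE negb_or => /andP[n1 n2].
  rewrite /g1 (negPf n1) (negPf n2).
  have kF := sp _ kp.
  rewrite -(inj_in_eq (can_in_inj (ioK wfF))) ?(io_in wfF) // (ioK wfF) //.
  rewrite (negPf n2) -(inj_in_eq (can_in_inj (ioK wfF))) ?(io_in wfF) //.
  by rewrite !(ioK wfF) // (negPf n1).
have g1h : g1 h = b by rewrite /g1 eqxx.
have g1i : g1 (io h) = c by rewrite /g1 (negPf (io_neq wfF hF)) eqxx.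
exists g1, b'; split=> [k|w].
  rewrite inE => /orP[/eqP->|kp].
    by rewrite g1h g1i /c; case: (b); case: (g0 h); case: (g0 (io h)).
  by have [-> ->] := g1E k kp; apply: cg.
rewrite big_cons g1h g1i nh.
under eq_big_seq => k kp do [have [-> ->] := g1E k kp].
rewrite sumg /endpoint /= sgN.
by case: (nu (io h) == w); case: (u == w); case: eqP => _; rewrite ?add0r; ring.
Qed.

Hypotheses (connF : connected_halves nu io F) (evenF : even_deg nu F).

Lemma exists_vtour h0 : h0 \in F ->
  exists p, [/\ vwalk (nu h0) p, vfin (nu h0) p = nu h0, simple io p &
    eset_of io p = F].
Proof.
move=> h0F.
pose P p := exists u, vwalk u p && simple io p.
have P0 : P [:: h0] by exists (nu h0); rewrite /= h0F eqxx (simple1 wfF).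
have Pb p : P p -> (size p <= #|H|)%N.
  by move=> [u /andP[_]]; apply: simple_size.
have [p [[u /andP[wp sp]] pmax]] := exists_longest P0 Pb.
have sub := walk_sub wp.
have noext u' q h : vwalk u' q -> simple io q -> size q = size p ->
    h \in F -> nu h = vfin u' q -> h \in edges io q.
  move=> wq sq szq hF nh; apply: contraT => hq.
  have /pmax : P (rcons q h).
    exists u'; rewrite walk_rcons wq hF nh eqxx simple_rcons //.
      by rewrite sq.
    exact: walk_sub wq.
  by rewrite size_rcons szq ltnn.
have closed : vfin u p = u.
  apply/eqP; apply: contraT => ne.
  have [k Ek] := card_halves_walk (vfin u p) wp sp.
  have [||h [hF nh]] := @exists_unused p (vfin u p) => //.
    apply/eqP => E; have := evenF (vfin u p); rewrite -E.
    by move: Ek; rewrite eqxx eq_sym (negPf ne); lia.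
  by move/negP; case; apply: (noext u p h wp sp (erefl _) hF nh).
have rot k : k \in edges io p ->
    exists q, [/\ vwalk (nu k) q, vfin (nu k) q = nu k, simple io q,
      size q = size p & eset_of io q = eset_of io p].
  move=> kp; have [p1 [p2 [E f1]]] := vwalk_split wp kp.
  exists (p2 ++ p1).
  move: wp closed; rewrite E walk_cat f1 fin_cat f1 => /andP[w1 w2] f2.
  rewrite walk_cat w2 f2 w1 fin_cat f2 f1; split=> //.
  - by rewrite simple_catC -E.
  - by rewrite !size_cat addnC.
  - by rewrite eset_of_catC.
have all_used k h : k \in edges io p -> h \in F -> nu h = nu k ->
    h \in edges io p.
  move=> kp hF nh; have [q [wq fq sq szq Eq]] := rot k kp.
  have : h \in eset_of io q by rewrite inE; apply: noext wq sq szq hF _; rewrite fq.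
  by rewrite Eq inE.
have coverE h : h \in F -> h \in edges io p.
  pose Y := [set w | has (fun k => nu k == w) (edges io p)].
  have inY k : k \in edges io p -> nu k \in Y.
    by move=> kp; rewrite inE; apply/hasP; exists k.
  have used k : k \in F -> nu k \in Y -> k \in edges io p.
    move=> kF; rewrite inE => /hasP[k' kp' /eqP E].
    exact: all_used kp' kF (esym E).
  move=> hF; apply: (used) => //; apply: (connF (Y := Y)) => //.
    move=> k kF kY; apply: inY; rewrite (edges_io wfF) //; exact: used.
  have [k kp] : exists k, k \in p.
    by case: (p) (pmax _ P0) => // k p1 _; exists k; rewrite inE eqxx.
  by exists k; [apply: sub | apply: inY; rewrite mem_cat kp].
have [q [wq fq sq _ Eq]] := rot _ (coverE _ h0F).
exists q; split=> //; rewrite Eq; apply/setP => h; rewrite inE.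
by apply/idP/idP => [/(edges_sub wfF sub)|/coverE].
Qed.

(** The first and the last half-edge of the tour lie at the root and give [b1] and [b2]. *)
Lemma euler_orientation (g0 : H -> bool) h0 : h0 \in F ->
  exists g, [/\ compat io F g g0,
    forall w, w != nu h0 -> excess nu F (fun h => sg (g h)) w = 0 &
    exists b1 b2, excess nu F (fun h => sg (g h)) (nu h0) = sg b1 + sg b2].
Proof.
move=> h0F; have [p [wp fp sp EF]] := exists_vtour h0F.
have [g [b' [cg sumg]]] := orient_walk g0 true wp sp.
have exE w : excess nu F (fun h => sg (g h)) w =
   (if nu h0 == w then sg true else 0) + (if nu h0 == w then sg b' else 0).
  by rewrite /excess -{1}EF sum_edges // sumg fp.
exists g; split.
- move=> h hF; have: h \in eset_of io p by rewrite EF.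
  rewrite inE (mem_edges wfF) //; last exact: walk_sub wp.
  case/orP=> [/cg//|/cg]; rewrite (ioK wfF) //.
- by move=> w; rewrite exE eq_sym => /negPf->.
- by exists true, b'; rewrite exE eqxx.
Qed.

End Euler.

(** * Two-edge-cuts *)

Section TwoCuts.
Variables (H V : finType) (nu : H -> V).
Implicit Types (io : H -> H) (F : {set H}) (g : H -> bool) (Y : {set V}).

(** One half-edge for each edge of the cut, so the cardinal is the size of the cut. *)
Definition boundary io F Y : {set H} :=
  [set h in F | (nu h \in Y) && (nu (io h) \notin Y)].

Definition side F Y : {set H} := [set h in F | nu h \in Y].

(* [twist] joins the half-edges [h1] and [h2] of a 2-edge-cut into a single edge,
   which stands for the other side of the cut. *)
Definition twist io (h1 h2 h : H) : H :=
  if h == h1 then h2 else if h == h2 then h1 else io h.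

Lemma compat_sg io F g g' h : compat io F g g' -> h \in F ->
  sg (g (io h)) * sg (g' (io h)) = sg (g h) * sg (g' h).
Proof.
by move=> C /C; case: (g h); case: (g' h); case: (g (io h)); case: (g' (io h)).
Qed.

Lemma even_degP F v : even_deg nu F -> exists k : int, #|halves nu F v|%:Z = 2 * k.
Proof. by move=> /(_ v); exists (#|halves nu F v|./2)%:Z; lia. Qed.

Lemma excess_even F g v : even_deg nu F ->
  exists k : int, excess nu F (fun h => sg (g h)) v = 2 * k.
Proof.
move=> /(even_degP v)[k Ek]; have [k' Ek'] := sum_sg_parity (halves nu F v) g.
exists (k + k'); rewrite mulrDr -Ek -Ek' /excess.
by apply: eq_bigl => h; rewrite inE.
Qed.

Lemma even_deg_excess F g : (forall v, (2 %| excess nu F (fun h => sg (g h)) v)%Z) ->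
  even_deg nu F.
Proof.
move=> E v; have [k Ek] := sum_sg_parity (halves nu F v) g.
move: (E v); suff -> : excess nu F (fun h => sg (g h)) v = #|halves nu F v|%:Z + 2 * k.
  by lia.
by rewrite -Ek; apply: eq_bigl => h; rewrite inE.
Qed.

(** The half-edges where [g] and [g'] differ come in pairs, and each changes the sum by 2 or -2.
    Hence the sum modulo 4 belongs to the signed graph; it records the parity of the number of
    negative edges. *)
Lemma compat_mod4 io F g g' : wf io F -> compat io F g g' ->
  (4 %| \sum_(h in F) sg (g h) - \sum_(h in F) sg (g' h))%Z.
Proof.
move=> wfF C; pose S := [set h in F | g h != g' h].
have SF : S \subset F by apply/subsetP => h; rewrite inE => /andP[].
have Scl h : h \in S -> io h \in S.
  rewrite !inE => /andP[hF]; rewrite (io_in wfF) //=.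
  have := C h hF.
  by case: (g h); case: (g' h); case: (g (io h)); case: (g' (io h)).
have evS := even_closed wfF SF Scl.
have [k Ek] := sum_sg_parity S g.
suff -> : \sum_(h in F) sg (g h) - \sum_(h in F) sg (g' h) = 2 * (#|S|%:Z + 2 * k).
  by lia.
rewrite -Ek mulr_sumr -sumrB [RHS](eq_bigl (fun h => (h \in F) && (g h != g' h))).
  rewrite big_mkcondr; apply: eq_bigr => h _.
  by case: (g h); case: (g' h).
by move=> h; rewrite inE.
Qed.

Lemma sum_part F Y f : \sum_(h in side F Y) f h = \sum_(h in F | nu h \in Y) f h :> int.
Proof. by apply: eq_bigl => h; rewrite inE. Qed.

Lemma excess_part F Y f v : v \in Y -> excess nu (side F Y) f v = excess nu F f v.
Proof.
move=> vY; apply: eq_bigl => h; rewrite inE.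
by case: eqP => [->|]; rewrite ?vY ?andbT ?andbF.
Qed.

Lemma excess_part0 F Y f v : v \notin Y -> excess nu (side F Y) f v = 0.
Proof.
move=> vY; apply: big_pred0 => h; rewrite inE.
by case: eqP => [->|]; rewrite ?(negPf vY) ?andbF.
Qed.

Lemma sum_partC F Y f :
  \sum_(h in F) f h = \sum_(h in side F Y) f h + \sum_(h in side F (~: Y)) f h :> int.
Proof.
rewrite (bigID (fun h => nu h \in Y)) /= !sum_part; congr (_ + _).
by apply: eq_bigl => h; rewrite inE.
Qed.

Lemma even_deg_part F Y : even_deg nu F -> even_deg nu (side F Y).
Proof.
move=> E v; have [vY|vY] := boolP (v \in Y).
  suff -> : halves nu (side F Y) v = halves nu F v by [].
  apply/setP => h; rewrite !inE; case: eqP => [->|]; rewrite ?vY ?andbT ?andbF //.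
suff -> : halves nu (side F Y) v = set0 by rewrite cards0.
apply/setP => h; rewrite !inE; case: eqP => [->|]; rewrite ?(negPf vY) ?andbF //.
Qed.

Section Cut.
Variables (io : H -> H) (F : {set H}) (Y : {set V}) (h1 h2 : H).
Hypotheses (wfF : wf io F) (bdY : boundary io F Y = [set h1; h2]) (h12 : h1 != h2).

Let io' := twist io h1 h2.

Lemma cut_ends : [/\ h1 \in F, nu h1 \in Y & nu (io h1) \notin Y] /\
  [/\ h2 \in F, nu h2 \in Y & nu (io h2) \notin Y].
Proof.
have : h1 \in boundary io F Y by rewrite bdY !inE eqxx.
have : h2 \in boundary io F Y by rewrite bdY !inE eqxx orbT.
by rewrite !inE => /and3P[-> -> ->] /and3P[-> -> ->].
Qed.

Lemma cut_cases h : h \in F -> nu h \in Y -> nu (io h) \notin Y -> h = h1 \/ h = h2.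
Proof.
move=> hF hY ihY; have : h \in boundary io F Y by rewrite !inE hF hY.
by rewrite bdY !inE => /orP[/eqP|/eqP]; [left|right].
Qed.

Lemma twist_inside h : h \in F -> nu (io h) \in Y -> io' h = io h.
Proof.
move=> hF ihY; have [[_ _ n1] [_ _ n2]] := cut_ends.
by rewrite /io' /twist; case: eqP ihY n1 => [-> ->|_ ihY _] //; case: eqP ihY n2 => [-> ->|].
Qed.

Lemma twist1 : io' h1 = h2. Proof. by rewrite /io' /twist eqxx. Qed.
Lemma twist2 : io' h2 = h1.
Proof. by rewrite /io' /twist eq_sym (negPf h12) eqxx. Qed.

Lemma boundaryC : boundary io F (~: Y) = [set io h1; io h2].
Proof.
have [[F1 Y1 n1] [F2 Y2 n2]] := cut_ends.
apply/setP => h; rewrite !inE negbK; apply/and3P/orP.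
  move=> [hF hY ihY]; have iihY : nu (io (io h)) \notin Y by rewrite (ioK wfF).
  by have [<-|<-] := cut_cases (io_in wfF hF) ihY iihY; rewrite (ioK wfF hF); [left|right].
by case=> /eqP->; rewrite (io_in wfF) // (ioK wfF).
Qed.

Lemma io_h12 : io h1 != io h2.
Proof.
have [[F1 _ _] [F2 _ _]] := cut_ends.
by apply: contra h12 => /eqP /(congr1 io); rewrite !(ioK wfF) // => ->.
Qed.

Lemma wf_twist : wf io' (side F Y).
Proof.
move=> h; rewrite inE => /andP[hF hY].
have [[F1 Y1 n1] [F2 Y2 n2]] := cut_ends.
have [ihY|ihY] := boolP (nu (io h) \in Y).
  have ihF := io_in wfF hF.
  rewrite twist_inside // twist_inside ?(ioK wfF) //.
  by rewrite inE ihF ihY (io_neq wfF).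
have [->|->] := cut_cases hF hY ihY.
  by rewrite twist1 twist2 inE F2 Y2 eq_sym.
by rewrite twist2 twist1 inE F1 Y1.
Qed.

Lemma conn_twist : connected_halves nu io F -> connected_halves nu io' (side F Y).
Proof.
move=> connF Y' cl [k kF kY'] h; rewrite inE => /andP[hF hY].
have [[F1 Y1 n1] [F2 Y2 n2]] := cut_ends.
have P1 : h1 \in side F Y by rewrite inE F1.
have P2 : h2 \in side F Y by rewrite inE F2.
have E12 : (nu h1 \in Y') = (nu h2 \in Y').
  apply/idP/idP => [/(cl _ P1)|/(cl _ P2)]; first by rewrite twist1.
  by rewrite twist2.
(* The other side of the cut is contracted to one point, which joins [Z] together with the ends of
   the new edge. *)
pose Z := [set w | if w \in Y then w \in Y' else nu h1 \in Y'].
have : nu h \in Z; last by rewrite inE hY.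
apply: (connF Z) => //; last first.
  by move: kF; rewrite inE => /andP[kF kY]; exists k => //; rewrite inE kY.
move=> j jF; rewrite !inE.
have [jY|jY] := boolP (nu j \in Y); have [ijY|ijY] := boolP (nu (io j) \in Y) => //.
- have jP : j \in side F Y by rewrite inE jF.
  by move/(cl _ jP); rewrite twist_inside.
- by have [->|->] := cut_cases jF jY ijY; rewrite ?E12.
- have iijY : nu (io (io j)) \notin Y by rewrite (ioK wfF).
  by have [->|->] := cut_cases (io_in wfF jF) ijY iijY; rewrite -?E12.
Qed.

End Cut.

(** As the far side has a sum divisible by 4, closing it up by an edge gives a graph with an
    orientation of excess 0. This flow with values 1 and -1 is scaled to match [xi] on both cut
    edges, whose values agree since the edge replacing the far side carries a single value. *)
Lemma extend_two_cut io F Y h1 h2 g (xi : H -> int) :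
  wf io F -> connected_halves nu io F -> even_deg nu F ->
  boundary io F Y = [set h1; h2] -> h1 != h2 ->
  (4 %| \sum_(h in side F (~: Y)) sg (g h))%Z ->
  {in side F Y, forall h, xi (twist io h1 h2 h) = xi h} ->
  exists xi', [/\ forall h, nu h \in Y -> xi' h = xi h,
    {in F, forall h, xi' (io h) = xi' h},
    {in F, forall h, nu h \notin Y -> `|xi' h| = `|xi h1|} &
    forall w, w \notin Y -> excess nu F (fun h => sg (g h) * xi' h) w = 0].
Proof.
move=> wfF connF evF bdY h12 sum4 xiE.
have [[F1 Y1 n1] [F2 Y2 n2]] := cut_ends bdY.
have bdX := boundaryC wfF bdY.
have k12 := io_h12 wfF bdY h12.
have wfX := wf_twist wfF bdX k12; have connX := conn_twist wfF bdX k12 connF.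
have evX := even_deg_part (~: Y) evF.
have k1X : io h1 \in side F (~: Y) by rewrite !inE (io_in wfF) // n1.
have k2X : io h2 \in side F (~: Y) by rewrite !inE (io_in wfF) // n2.
have [gX [cX ex0 [b1 [b2 exb]]]] := euler_orientation wfX connX evX g k1X.
have exX w : excess nu (side F (~: Y)) (fun h => sg (gX h)) w = 0.
  have [->|/ex0//] := eqVneq w (nu (io h1)); rewrite exb.
  have := compat_mod4 wfX cX; rewrite (sum_excess_all nu (side F (~: Y)) (fun h => sg (gX h))).
  rewrite (bigD1 (nu (io h1))) //= big1 ?addr0 ?exb; last by move=> v /ex0.
  exact: sg_add_eq0 sum4.
(* [phi] rewrites [gX] as a flow with values 1 and -1 relative to [g]. *)
pose phi h := sg (g h) * sg (gX h).
have phiE h : h \in side F (~: Y) -> phi (twist io (io h1) (io h2) h) = phi h.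
  by move=> hX; rewrite /phi mulrC (compat_sg cX hX) mulrC.
have phi2 h : phi h * phi h = 1 by rewrite /phi; case: (g h); case: (gX h).
have phin h : `|phi h| = 1 by rewrite /phi; case: (g h); case: (gX h).
have phi12 : phi (io h2) = phi (io h1) by rewrite -(phiE _ k1X) twist1.
have xi12 : xi h2 = xi h1.
  by rewrite -(xiE h1) ?twist1 // inE F1.
(* The factor [phi (io h1)] makes the value at [io h1] equal to [xi h1]. *)
pose xi' h := if nu h \in Y then xi h else xi h1 * phi (io h1) * phi h.
have bd_xi h : h \in F -> nu h \in Y -> nu (io h) \notin Y -> xi' (io h) = xi' h.
  move=> hF hY ihY; rewrite /xi' hY (negPf ihY).
  by have [->|->] := cut_cases bdY hF hY ihY; rewrite ?phi12 ?xi12 -mulrA phi2 mulr1.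
exists xi'; split.
- by move=> h hY; rewrite /xi' hY.
- move=> h hF.
  have [hY|hY] := boolP (nu h \in Y); have [ihY|ihY] := boolP (nu (io h) \in Y).
  + rewrite /xi' hY ihY -[RHS]xiE ?inE ?hF //.
    by rewrite (twist_inside bdY).
  + exact: bd_xi.
  + by have := bd_xi _ (io_in wfF hF) ihY; rewrite (ioK wfF hF) => ->.
  + rewrite /xi' (negPf hY) (negPf ihY); congr (_ * _).
    by rewrite -[RHS]phiE ?inE ?hF // (twist_inside bdX) // inE.
- by move=> h hF hY; rewrite /xi' (negPf hY) 2!normrM !phin !mulr1.
move=> w wY; rewrite -(@excess_part _ (~: Y)) ?inE //.
rewrite -[RHS](mulr0 (xi h1 * phi (io h1))) -(exX w) -excessZ.
apply: eq_excess => h; rewrite !inE => /andP[_ hY].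
by rewrite /xi' (negPf hY) /phi; case: (g h); case: (gX h); rewrite /sg; ring.
Qed.

End TwoCuts.

(** * Alternating walks and switching *)

Section SignedWalks.
Variables (H V : finType) (nu : H -> V).
Implicit Types (io : H -> H) (F : {set H}) (g : H -> bool) (X Y : {set V}).
Implicit Types (x y : V * bool) (p q : seq H).

(* The state [(v, b)] means "at [v], having arrived through a half-edge of sign
   [b]": an alternating walk must leave it through a half-edge of sign [~~ b]. *)
Definition sdep g h : V * bool := (nu h, ~~ g h).
Definition snx io g h : V * bool := (nu (io h), g (io h)).
Definition bar x : V * bool := (x.1, ~~ x.2).

Lemma barK : involutive bar. Proof. by case=> w s; rewrite /bar negbK. Qed.

Notation swalk io F g := (walk (sdep g) (snx io g) F).
Notation sfin io g := (endpoint (snx io g)).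

Lemma swalk_rev io F g x p : wf io F -> swalk io F g x p ->
  swalk io F g (bar (sfin io g x p)) (rev_walk io p) /\
  sfin io g (bar (sfin io g x p)) (rev_walk io p) = bar x.
Proof.
move=> wfF; elim: p x => //= h p IH x /and3P[hF /eqP<- /IH[w1 f1]].
rewrite /rev_walk /= rev_cons -/(rev_walk io p) walk_rcons fin_rcons.
rewrite w1 (io_in wfF hF) f1 /snx /sdep /bar /= (ioK wfF hF) negbK.
by rewrite eqxx.
Qed.

(** The signs on arriving at and on leaving an intermediate vertex are opposite and cancel. *)
Lemma sum_swalk io F g x p w : swalk io F g x p ->
  \sum_(h <- p) ((if nu h == w then sg (g h) else 0) +
                 (if nu (io h) == w then sg (g (io h)) else 0)) =
  (if (sfin io g x p).1 == w then sg (sfin io g x p).2 else 0) -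
  (if x.1 == w then sg x.2 else 0).
Proof.
move=> wp; pose phi y := if y.1 == w then sg y.2 else 0.
rewrite -(walk_telescope phi wp); apply: eq_bigr => h _.
by rewrite /phi /= sgN; case: eqP => _; case: eqP => _; ring.
Qed.

Lemma sum_mem F p (P : pred H) (f : H -> int) : uniq p -> {subset p <= F} ->
  \sum_(h in F | P h) f h * (h \in p)%:Z = \sum_(h <- p) if P h then f h else 0.
Proof.
move=> up sp; rewrite big_uniq //= big_mkcond [RHS]big_mkcond; apply: eq_bigr => h _.
case: (boolP (h \in p)) => [/sp->|_]; case: (P h); rewrite ?andbT ?andbF ?mulr1 ?mulr0 //.
by case: (h \in F).
Qed.

(** An edge inside [X] contributes 0 if exactly one half satisfies [t], and 2 if both do; the sum is
    doubled to pair [h] with [io h]. *)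
Lemma sum_inner io F X (t : H -> bool) : wf io F ->
  (forall h, h \in F -> nu h \in X -> nu (io h) \in X -> t h || t (io h)) ->
  \sum_(h in F | (nu h \in X) && (nu (io h) \in X)) sg (t h) =
  #|[set h in F | [&& nu h \in X, nu (io h) \in X, t h & t (io h)]]|%:Z.
Proof.
move=> wfF tt; set S := LHS.
have : S + S = #|[set h in F | [&& nu h \in X, nu (io h) \in X, t h & t (io h)]]|%:Z * 2.
  rewrite {2}/S (sum_io wfF) /S.
  rewrite [X in _ + X](eq_bigl (fun h => (h \in F) && ((nu h \in X) && (nu (io h) \in X)))).
    rewrite -big_split /= -[_%:Z]natz -[_%:R]/(1 *+ _) -sumr_const mulr_suml.
    rewrite [RHS]big_mkcond [LHS]big_mkcond; apply: eq_bigr => h _; rewrite inE.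
    case: ifP => [/and3P[hF h1 h2]|]; last by case: (h \in F); case: (_ \in X); case: (_ \in X).
    by rewrite hF h1 h2 /=; move: (tt h hF h1 h2); case: (t h); case: (t (io h)).
  by move=> h; case: (boolP (h \in F)) => //= hF; rewrite (ioK wfF hF) andbC.
by move: (S); lia.
Qed.

(** Comparison with [s] is switching: [sg (g h == b)] equals [sg b * sg (g h)]. *)
Lemma sum_signed F X (s : V -> bool) g :
  \sum_(h in F | nu h \in X) sg (g h == s (nu h)) =
  \sum_(w in X) sg (s w) * excess nu F (fun h => sg (g h)) w.
Proof.
rewrite sum_excess; apply: eq_bigr => w _; rewrite -excessZ; apply: eq_bigr => h.
by case/andP=> _ /eqP->; case: (g h); case: (s w).
Qed.

Lemma sum_boundary io F X (f : H -> int) :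
  \sum_(h in F | nu h \in X) f h =
  \sum_(h in F | (nu h \in X) && (nu (io h) \in X)) f h +
  \sum_(h in boundary nu io F X) f h.
Proof.
rewrite (bigID (fun h => nu (io h) \in X)) /=; congr (_ + _).
  by apply: eq_bigl => h; rewrite andbA.
by apply: eq_bigl => h; rewrite inE andbA.
Qed.

(** Up to switching by [s], every edge but that of [e] is positive. *)
Definition near_balanced io F g : Prop :=
  exists (s : V -> bool) e, e \in F /\ forall h, h \in F -> h != e -> h != io e ->
    g h (+) s (nu h) != g (io h) (+) s (nu (io h)).

Lemma near_balanced_compat io F g g' : compat io F g' g ->
  near_balanced io F g' -> near_balanced io F g.
Proof.
move=> C [s [e [eF E]]]; exists s, e; split=> // h hF h1 h2.
have := E h hF h1 h2; have := C h hF.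
by case: (g h); case: (g' h); case: (g (io h)); case: (g' (io h));
  case: (s _); case: (s _).
Qed.

Definition has_4flow io F g : Prop := exists xi : H -> int,
  (forall h, h \in F -> xi (io h) = xi h /\ 1 <= `|xi h| <= 3) /\
  forall v, excess nu F (fun h => sg (g h) * xi h) v = 0.

Lemma has_4flow_compat io F g g' : compat io F g' g ->
  has_4flow io F g' -> has_4flow io F g.
Proof.
move=> C [xi [xi1 xi2]]; exists (fun h => sg (g h) * sg (g' h) * xi h); split.
  move=> h hF; have [-> xib] := xi1 h hF.
  rewrite [sg (g (io h)) * _]mulrC (compat_sg C hF) [sg (g' h) * _]mulrC.
  by split=> //; rewrite !normrM; case: (g h); case: (g' h); rewrite !mul1r.
move=> v; rewrite -(xi2 v); apply: eq_bigr => h _.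
by rewrite !mulrA sgM mul1r.
Qed.

End SignedWalks.

(** * Nowhere-zero 4-flows *)

Section FourFlows.
Variables (H V : finType) (nu : H -> V).
Implicit Types (io : H -> H) (F : {set H}) (g : H -> bool) (X Y : {set V}).

Notation swalk io F g := (walk (sdep nu g) (snx nu io g) F).
Notation sfin io g := (endpoint (snx nu io g)).

(** After removal of repetitions the walk uses each edge at most twice. Its excess is -2 at [v] and
    0 elsewhere, which cancels that of the constant function 1. *)
Lemma walk_4flow io F g v p : wf io F ->
  (forall w, excess nu F (fun h => sg (g h)) w = if w == v then 2 else 0) ->
  swalk io F g (v, true) p -> sfin io g (v, true) p = (v, false) ->
  has_4flow nu io F g.
Proof.
move=> wfF exg /walk_uniq[q [wq fq _ uq]] fp; rewrite fp in fq.
have sq := walk_sub wq.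
pose y h := (h \in q)%:Z + (io h \in q)%:Z.
exists (fun h => 1 + y h); split.
  move=> h hF; rewrite /y (ioK wfF hF) addrC [1 + _]addrC [X in X + 1 = _]addrC.
  by split=> //; case: (h \in q); case: (io h \in q).
move=> w; rewrite (@eq_excess _ _ nu F _ (fun h => sg (g h) + sg (g h) * (h \in q)%:Z +
    sg (g h) * (io h \in q)%:Z)); last by move=> h _; rewrite /y; ring.
have E2 : excess nu F (fun h => sg (g h) * (io h \in q)%:Z) w =
    \sum_(h <- q) if nu (io h) == w then sg (g (io h)) else 0.
  rewrite -(sum_mem (fun h => nu (io h) == w) (fun h => sg (g (io h))) uq sq).
  rewrite /excess (sum_io wfF); apply: eq_bigr => h /andP[hF _].
  by rewrite (ioK wfF hF).
rewrite !excessD exg E2 /excess (sum_mem _ _ uq sq).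
rewrite -addrA -big_split /= (sum_swalk w wq) fq /= eq_sym.
by case: eqP => _.
Qed.

Lemma card_io_pair io F (S : {set H}) : wf io F -> S \subset F ->
  (forall h, h \in S -> io h \in S) -> #|S| = 2%N ->
  exists2 e, e \in S & S = [set e; io e].
Proof.
move=> wfF SF Scl S2; have [/eqP|[e eS]] := set_0Vmem S.
  by rewrite -cards_eq0 S2.
have eF := subsetP SF _ eS.
exists e => //; apply/esym/eqP; rewrite eqEcard subUset !sub1set eS Scl //=.
by rewrite S2 cards2 eq_sym (io_neq wfF eF).
Qed.

(** The condition on [k1] and [k2] says that the edge replacing [X] has the sign of a path through
    [X]. So the potential outside [X] is continued by [s] inside, up to a constant shift [c]. *)
Lemma near_balanced_extend io F X g s k1 k2 : wf io F ->
  boundary nu io F X = [set k1; k2] -> k1 != k2 ->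
  (forall h, h \in F -> nu h \in X -> nu (io h) \in X ->
     g h (+) s (nu h) != g (io h) (+) s (nu (io h))) ->
  g k1 (+) s (nu k1) != g k2 (+) s (nu k2) ->
  near_balanced nu (twist io (io k1) (io k2)) (side nu F (~: X)) g ->
  near_balanced nu io F g.
Proof.
move=> wfF bdX k12 inX gk [s' [e [eN near]]].
have [[F1 X1 n1] [F2 X2 n2]] := cut_ends bdX.
have bdN := boundaryC wfF bdX.
have h12 := io_h12 wfF bdX k12.
move: eN; rewrite inE => /andP[eF eX].
pose sc c w := if w \in X then s w (+) c else s' w.
pose good c h := g h (+) sc c (nu h) != g (io h) (+) sc c (nu (io h)).
have goodX c h : h \in F -> nu h \in X -> nu (io h) \in X -> good c h.
  move=> hF hX ihX; rewrite /good /sc hX ihX; have := inX h hF hX ihX.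
  by case: (g h); case: (g (io h)); case: (s _); case: (s _); case: c.
have good_io c h : h \in F -> good c (io h) = good c h.
  by move=> hF; rewrite /good (ioK wfF hF) eq_sym.
suff [c [e' [e'F Ee']]] : exists c e', e' \in F /\
    (forall h, h \in F -> nu h \notin X -> h != e' -> h != io e' -> good c h).
  exists (sc c), e'; split=> // h hF h1 h2; rewrite -/(good c h).
  have [hX|hX] := boolP (nu h \in X); last exact: Ee'.
  have [ihX|ihX] := boolP (nu (io h) \in X); first exact: goodX.
  rewrite -good_io //; apply: Ee'; rewrite ?(io_in wfF) //.
    by apply: contra h2 => /eqP <-; rewrite (ioK wfF hF).
  by apply: contra h1 => /eqP /(congr1 io); rewrite !(ioK wfF) // => ->.
have goodN c h : h \in F -> nu h \notin X -> nu (io h) \notin X ->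
    h != e -> h != twist io (io k1) (io k2) e -> good c h.
  move=> hF hX ihX h1 h2; rewrite /good /sc (negPf hX) (negPf ihX).
  have hN : h \in side nu F (~: X) by rewrite !inE hF.
  by have := near h hN h1 h2; rewrite (twist_inside bdN) // inE.
have good1 c : good c (io k1) =
    (g (io k1) (+) s' (nu (io k1)) != g k1 (+) s (nu k1) (+) c).
  by rewrite /good /sc (ioK wfF) // X1 (negPf n1) addbA.
have good2 c : good c (io k2) =
    (g (io k2) (+) s' (nu (io k2)) != g k2 (+) s (nu k2) (+) c).
  by rewrite /good /sc (ioK wfF) // X2 (negPf n2) addbA.
have out h : h \in F -> nu h \notin X -> nu (io h) \in X -> h = io k1 \/ h = io k2.
  by move=> hF hX ihX; apply: (cut_cases bdN) => //; rewrite inE ?negbK.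
have [/orP e12|] := boolP ((e == io k1) || (e == io k2)).
  (* If the exceptional edge is the one replacing [X], the cut edge at [k1] becomes exceptional and
     [c] is chosen to make the one at [k2] positive. *)
  exists (~~ (g (io k2) (+) s' (nu (io k2)) (+) (g k2 (+) s (nu k2)))), (io k1).
  split=> [|h hF hX h1 h2]; first exact: (io_in wfF).
  have [ihX|ihX] := boolP (nu (io h) \in X).
    have [E|->] := out h hF hX ihX; first by rewrite E eqxx in h1.
    rewrite good2; case: (g (io k2)); case: (s' _); case: (g k2); by case: (s _).
  have h3 : h != io k2.
    by apply: contraNneq ihX => ->; rewrite (ioK wfF F2).
  apply: goodN => //; first by case: e12 => /eqP->.
  by case: e12 => /eqP->; rewrite ?twist1 ?twist2.
rewrite negb_or => /andP[e1 e2].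
have ieX : nu (io e) \notin X.
  apply/negP => ieX; have [||E|E] := out e eF => //; first by rewrite inE in eX.
    by rewrite E eqxx in e1.
  by rewrite E eqxx in e2.
have te : twist io (io k1) (io k2) e = io e by rewrite (twist_inside bdN) // inE.
have near12 : g (io k1) (+) s' (nu (io k1)) != g (io k2) (+) s' (nu (io k2)).
  have := near (io k1); rewrite te twist1; apply; last 1 first.
  - apply/eqP => /(congr1 io); rewrite !(ioK wfF) // => E.
    by move: eX; rewrite -E inE X1.
  - by rewrite !inE (io_in wfF) // n1.
  - by rewrite eq_sym.
(* Otherwise [c] makes the cut edge at [k1] positive; that at [k2] follows, because the edge
   replacing [X] is positive. *)
exists (~~ (g (io k1) (+) s' (nu (io k1)) (+) (g k1 (+) s (nu k1)))), e.
split=> // h hF hX h1 h2.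
have [ihX|ihX] := boolP (nu (io h) \in X); last by apply: goodN; rewrite ?te.
have [->|->] := out h hF hX ihX.
  rewrite good1; case: (g (io k1)); case: (s' _); case: (g k1); by case: (s _).
rewrite good2; move: near12 gk.
case: (g (io k1)); case: (s' _); case: (g k1); case: (s _);
case: (g (io k2)); case: (s' _); case: (g k2); by case: (s _).
Qed.

End FourFlows.

Section FourFlowTheorem.
Variables (H V : finType) (nu : H -> V).
Implicit Types (io : H -> H) (F : {set H}) (g : H -> bool) (X Y : {set V}).

Notation swalk io F g := (walk (sdep nu g) (snx nu io g) F).
Notation sfin io g := (endpoint (snx nu io g)).

Lemma euler_odd io F g h0 : wf io F -> connected_halves nu io F -> even_deg nu F ->
  ~~ (4 %| \sum_(h in F) sg (g h))%Z -> h0 \in F ->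
  exists g', compat io F g' g /\
    forall w, excess nu F (fun h => sg (g' h)) w = if w == nu h0 then 2 else 0.
Proof.
move=> wfF connF evF odd4 h0F.
have [g1 [c1 ex0 [b1 [b2 exb]]]] := euler_orientation wfF connF evF g h0F.
have := compat_mod4 wfF c1.
rewrite (sum_excess_all nu F (fun h => sg (g1 h))) (bigD1 (nu h0)) //= exb.
rewrite big1 ?addr0 => [mod4|w /ex0 //].
have b12 : b2 = b1 := sg_add_neq0 odd4 mod4.
(* Both signs at the root are [b1]; reversing all edges when it is false turns excess -2 into 2. *)
pose g2 h := g1 h (+) ~~ b1.
exists g2; split.
  move=> h hF; have := c1 h hF; rewrite /g2.
  by case: (g1 h); case: (g h); case: (g1 (io h)); case: (g (io h)); case: (b1).
move=> w; rewrite (@eq_excess _ _ nu F _ (fun h => sg b1 * sg (g1 h))); last first.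
  by move=> h _; rewrite /g2; case: (g1 h); case: (b1).
rewrite excessZ; case: eqP => [->|/eqP/ex0->]; rewrite ?mulr0 //.
by rewrite exb b12; case: (b1).
Qed.

Lemma mod4_split (a b c : int) :
  (4 %| a + b - c)%Z -> (4 %| a)%Z -> ~~ (4 %| c)%Z -> ~~ (4 %| b)%Z.
Proof. by lia. Qed.

(** Every excess is even, so multiplying it by [sg (s w)] does not change it modulo 4. *)
Lemma sum_part_mod4 F X (s : V -> bool) g : even_deg nu F ->
  \sum_(h in F | nu h \in X) sg (g h == s (nu h)) = 0 ->
  (4 %| \sum_(h in side nu F X) sg (g h))%Z.
Proof.
move=> evF; rewrite sum_signed sum_part sum_excess => S0.
suff : (4 %| \sum_(w in X) excess nu F (fun h => sg (g h)) w -
   \sum_(w in X) sg (s w) * excess nu F (fun h => sg (g h)) w)%Z by rewrite S0 subr0.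
rewrite -sumrB; apply: rpred_sum => w _.
have [k ->] := excess_even g w evF.
suff : (4 %| 2 * k - sg (s w) * (2 * k))%Z by [].
by case: (s w); rewrite /sg; lia.
Qed.

Theorem near_balanced_or_4flow io F g : wf io F -> connected_halves nu io F -> even_deg nu F ->
  ~~ (4 %| \sum_(h in F) sg (g h))%Z ->
  near_balanced nu io F g \/ has_4flow nu io F g.
Proof.
have [n] := ubnP #|F|; elim: n io F g => // n IH io F g ltn wfF connF evF odd4.
have [F0|[h0 h0F]] := set_0Vmem F; first by move: odd4; rewrite F0 big_set0.
have [gE [cE exE]] := euler_odd wfF connF evF odd4 h0F.
set v := nu h0 in exE.
pose reach x := exists p, swalk io F gE (v, true) p /\ sfin io gE (v, true) p = x.
have r0 : reach (v, true) by exists [::].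
have ext h : h \in F -> reach (sdep nu gE h) -> reach (snx nu io gE h).
  move=> hF [p [wp fp]]; exists (rcons p h).
  by rewrite walk_rcons wp hF fp eqxx fin_rcons.
have [[p [wp fp]]|nr] := pselect (reach (v, false)).
  right; apply: has_4flow_compat cE _; exact: walk_4flow wfF exE wp fp.
(* A walk to [(w, b)] followed by the reversal of a walk to [(w, ~~ b)] would return to [v] with
   sign -. *)
have r_uniq w b : reach (w, b) -> reach (w, ~~ b) -> False.
  move=> [p [wp fp]] [q [wq fq]]; apply: nr.
  have [w1 f1] := swalk_rev wfF wq.
  exists (p ++ rev_walk io q).
  by move: w1 f1; rewrite walk_cat wp fin_cat fp fq /bar /= negbK.
pose s w := `[< reach (w, true) >].
pose X := [set w | `[< exists b, reach (w, b) >]].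
have inX w b : reach (w, b) -> (w \in X) /\ s w = b.
  move=> rw; split; first by rewrite inE; apply/asboolP; exists b.
  case: b rw => rw; first by apply/asboolP.
  by apply/negP => /asboolP rw'; apply: (r_uniq _ _ rw').
have reachX w : w \in X -> reach (w, s w).
  rewrite inE => /asboolP[b rw]; by have [_ ->] := inX _ _ rw.
clearbody X.
pose t h := gE h == s (nu h).
(* A half-edge that disagrees with the label of its vertex can be left through, so the other end is
   reached and its label is the sign of [io h]. *)
have step h : h \in F -> nu h \in X -> ~~ t h -> nu (io h) \in X /\ t (io h).
  move=> hF hX th; have := reachX _ hX => rh.
  have /(ext h hF) : reach (sdep nu gE h).
    by rewrite /sdep; move: th rh; rewrite /t; case: (gE h); case: (s _).
  by move=> /inX[-> sE]; rewrite /t sE eqxx.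
pose A := [set h in F | [&& nu h \in X, nu (io h) \in X, t h & t (io h)]].
pose B := boundary nu io F X.
have sumA := sum_inner (X := X) (t := t) wfF.
have tt h : h \in F -> nu h \in X -> nu (io h) \in X -> t h || t (io h).
  move=> hF hX _; case th: (t h) => //=.
  by have [|_ ->] := step h hF hX; rewrite ?th.
have [vX sv] := inX _ _ r0.
(* The signed excess over [X] is 2, contributed by [v] alone. Half-edges of [A] count 1, other inner
   edges cancel, and boundary half-edges agree with [s], as a disagreeing one would lead back into
   [X]. *)
have cardAB : #|A|%:Z + #|B|%:Z = 2.
  have <- : \sum_(w in X) sg (s w) * excess nu F (fun h => sg (gE h)) w = 2.
    rewrite (bigD1 v) //= sv exE eqxx big1 ?addr0 ?mul1r //.
    by move=> w /andP[_ /negPf wv]; rewrite exE wv mulr0.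
  rewrite -sum_signed (sum_boundary nu io) sumA //; congr (_ + _).
  rewrite -[LHS]natz -[_%:R]/(1 *+ _) -sumr_const; apply: eq_bigr => h.
  rewrite inE => /and3P[hF hX ihX]; case th: (gE h == s (nu h)) => //.
  by have [] := step h hF hX; rewrite /t ?th // (negPf ihX).
have AF : A \subset F by apply/subsetP => h; rewrite inE => /andP[].
have Acl h : h \in A -> io h \in A.
  rewrite !inE => /and5P[hF h1 h2 h3 h4].
  by rewrite (io_in wfF) // (ioK wfF) // h1 h2 h3 h4.
have evA := even_closed wfF AF Acl.
have [A2|A0] : (#|A| = 2 /\ #|B| = 0 \/ #|A| = 0 /\ #|B| = 2)%N by lia.
  left; apply: near_balanced_compat cE _.
  have [e eA EA] := card_io_pair wfF AF Acl A2.1.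
  have B0 : B = set0 by apply/eqP; rewrite -cards_eq0 A2.2.
  have allX : forall h, h \in F -> nu h \in X.
    apply: (connF X); last by exists h0.
    move=> h hF hX; apply: contraT => ihX.
    by have := in_set0 h; rewrite -B0 inE hF hX ihX.
  exists s, e; split; first exact: (subsetP AF).
  move=> h hF h1 h2; have : h \notin A by rewrite EA !inE negb_or h1.
  have := tt h hF (allX _ hF) (allX _ (io_in wfF hF)).
  rewrite inE hF !allX ?(io_in wfF) //= /t.
  by case: (gE h); case: (s _); case: (gE (io h)); case: (s _).
have A_empty : A = set0 by apply/eqP; rewrite -cards_eq0 A0.1.
have [k1 [k2 [k12 bdX]]] : exists k1 k2, k1 != k2 /\ B = [set k1; k2].
  by have /cards2P[k1 [k2 []]] : #|B| == 2 by [rewrite A0.2]; exists k1, k2.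
have [[F1 X1 n1] [F2 X2 n2]] := cut_ends bdX.
(* Reversing the cut edge at [k2] gives [k1] and [k2] opposite switched signs, so that [X] can act
   as one edge. *)
pose g1 h := gE h (+) ((h == k2) || (h == io k2)).
have c1 : compat io F g1 gE.
  move=> h hF; rewrite /g1 (can_in_eq (ioK wfF)) ?(io_in wfF) //.
  have -> : (io h == k2) = (h == io k2).
    by apply/eqP/eqP => [<-|->]; rewrite ?(ioK wfF).
  by rewrite orbC; case: (gE h); case: (gE (io h)); case: (_ || _).
have inner h : h \in F -> nu h \in X -> nu (io h) \in X ->
    g1 h = gE h /\ t h != t (io h).
  move=> hF hX ihX; rewrite /g1; split.
    have /negPf-> : h != k2 by apply: contraNneq n2 => <-.
    have /negPf-> : h != io k2 by apply: contraNneq n2 => <-.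
    by rewrite addbF.
  have := tt h hF hX ihX; have : h \notin A by rewrite A_empty inE.
  by rewrite inE hF hX ihX /=; case: (t h); case: (t (io h)).
have tB k : k \in F -> nu k \in X -> nu (io k) \notin X -> gE k = s (nu k).
  move=> kF kX ikX; case tk: (t k); first exact/eqP.
  by have [] := step k kF kX; rewrite ?tk // (negPf ikX).
have g1k1 : g1 k1 = s (nu k1).
  rewrite /g1 (negPf k12) tB //.
  have /negPf-> : k1 != io k2 by apply: contraNneq n2 => <-.
  by rewrite addbF.
have g1k2 : g1 k2 = ~~ s (nu k2) by rewrite /g1 eqxx tB // addbT.
have S0 : \sum_(h in F | nu h \in X) sg (g1 h == s (nu h)) = 0.
  rewrite (sum_boundary nu io) -/B bdX big_setU1 ?inE //= big_set1.
  rewrite g1k1 g1k2 eqxx; have -> : ~~ s (nu k2) == s (nu k2) = false by case: (s _).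
  rewrite addrN addr0.
  rewrite (eq_bigr (fun h => sg (t h))); last first.
    by move=> h /and3P[hF hX ihX]; have [-> _] := inner h hF hX ihX.
  by rewrite sumA // -/A A_empty cards0.
have mod4X := sum_part_mod4 evF S0.
have c1g : compat io F g1 g := compat_trans c1 cE.
have bdN := boundaryC wfF bdX; have h12 := io_h12 wfF bdX k12.
pose io' := twist io (io k1) (io k2).
have k1N : io k1 \in side nu F (~: X) by rewrite !inE (io_in wfF) // n1.
have ltN : (#|side nu F (~: X)| < n)%N.
  rewrite -ltnS; apply: leq_trans ltn; rewrite ltnS; apply: proper_card.
  apply/properP; split; first by apply/subsetP => h; rewrite inE => /andP[].
  by exists k1 => //; rewrite !inE X1 andbF.
have odd4N : ~~ (4 %| \sum_(h in side nu F (~: X)) sg (g1 h))%Z.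
  have := compat_mod4 wfF c1g.
  by rewrite (sum_partC nu F X) => /mod4_split; apply.
have [nb|[xi [xi1 xi2]]] := IH io' _ g1 ltN (wf_twist wfF bdN h12)
    (conn_twist wfF bdN h12 connF) (even_deg_part _ evF) odd4N.
  left; apply: near_balanced_compat c1g _.
  apply: (near_balanced_extend (s := s)) nb => //.
    move=> h hF hX ihX; have [E1 ne] := inner h hF hX ihX.
    have [|E2 _] := inner (io h) (io_in wfF hF) ihX; first by rewrite (ioK wfF).
    move: ne; rewrite E1 E2 /t.
    by case: (gE h); case: (s _); case: (gE (io h)); case: (s _).
  by rewrite g1k1 g1k2; case: (s _); case: (s _).
right; apply: has_4flow_compat c1g _.
have [||xi' [xi'N xi'io xi'X exX]] := extend_two_cut wfF connF evF bdN h12 (g := g1) (xi := xi).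
- by rewrite setCK.
- by move=> h hN; have [] := xi1 h hN.
exists xi'; split.
  move=> h hF; split; first exact: xi'io.
  have [hX|hX] := boolP (nu h \in X).
    rewrite xi'X ?inE ?negbK //; by have [] := xi1 _ k1N.
  rewrite xi'N ?inE //; have [|//] := xi1 h; by rewrite !inE hF.
move=> w; have [wX|wX] := boolP (w \in X); first by rewrite exX // inE negbK.
rewrite -(xi2 w) -(@excess_part _ _ nu _ (~: X)) ?inE //.
by apply: eq_excess => h; rewrite !inE => /andP[_ hX]; rewrite xi'N // inE.
Qed.

End FourFlowTheorem.

Lemma has_split (T : Type) (a : pred T) (s : seq T) : has a s ->
  exists s1 z s2, [/\ s = s1 ++ z :: s2, a z & ~~ has a s1].
Proof.
elim: s => //= z s IH; have [az _|az /= /IH[s1 [z' [s2 [-> az' n1]]]]] := boolP (a z).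
  by exists [::], z, s.
by exists (z :: s1), z', s2; rewrite /= negb_or az.
Qed.

(** * Alternating trails *)

Section Trails.
Variables (H V : finType) (nu : H -> V) (io : H -> H) (F : {set H}).
Variables (g : H -> bool) (x0 : V * bool).
Hypothesis wfF : wf io F.
Implicit Types (x y : V * bool) (p q r : seq H) (h k : H).

Notation swalk := (walk (sdep nu g) (snx nu io g) F).
Notation sfin := (endpoint (snx nu io g)).
Notation dep := (sdep nu g).
Notation nx := (snx nu io g).

Definition trail p := swalk x0 p && simple io p.
Definition reach x := exists p, trail p /\ sfin x0 p = x.

Lemma trail_sub p : trail p -> {subset p <= F}.
Proof. by case/andP=> /walk_sub. Qed.

Lemma has_edgesC p q : {subset p <= F} -> {subset q <= F} ->
  has (mem (edges io p)) q = has (mem (edges io q)) p.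
Proof.
have imp p1 p2 : {subset p1 <= F} -> {subset p2 <= F} ->
    has (mem (edges io p1)) p2 -> has (mem (edges io p2)) p1.
  move=> s1 s2 /hasP[h h2 /=]; rewrite (mem_edges wfF s1) ?s2 // => /orP[h1|h1].
    by apply/hasP; exists h => //=; rewrite mem_cat h2.
  apply/hasP; exists (io h) => //=; rewrite (edges_io wfF s2) ?s2 //.
  by rewrite mem_cat h2.
by move=> sp sq; apply/idP/idP; apply: imp.
Qed.

Lemma simple_suffix p q : {subset p ++ q <= F} -> simple io (p ++ q) -> simple io q.
Proof.
move=> s; rewrite (simple_cat wfF) => [/and3P[]//||] k kp; apply: s.
  by rewrite mem_cat kp.
by rewrite mem_cat kp orbT.
Qed.

Lemma trail_prefix p q : trail (p ++ q) -> trail p.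
Proof.
move=> T; have s := trail_sub T; case/andP: T.
rewrite walk_cat (simple_cat wfF).
- by move=> /andP[wp _] /and3P[sp _ _]; rewrite /trail wp.
- by move=> k kp; apply: s; rewrite mem_cat kp.
- by move=> k kp; apply: s; rewrite mem_cat kp orbT.
Qed.

Lemma trail_rcons p h : trail p -> h \in F -> dep h = sfin x0 p ->
  h \notin edges io p -> trail (rcons p h).
Proof.
move=> T hF dh hp; have s := trail_sub T; case/andP: T => wp sp.
by rewrite /trail walk_rcons wp hF dh eqxx (simple_rcons wfF s hF) sp.
Qed.

Lemma trail_mid p1 h p2 : trail (p1 ++ h :: p2) ->
  [/\ trail p1, sfin x0 p1 = dep h & trail (rcons p1 h)].
Proof.
move=> T; have T1 : trail (rcons p1 h) by move: T; rewrite -cat_rcons => /trail_prefix.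
split=> //; first by move: T1; rewrite -cats1 => /trail_prefix.
by case/andP: T1; rewrite walk_rcons => /and3P[_ _ /eqP->].
Qed.

(** [r] departs from the same state in both sequences, so after [p1] one may continue along the
    second, whose edges [p1] avoids. *)
Lemma splice_at p1 (r : H) p2 q1 q2 x : trail (p1 ++ r :: p2) ->
  swalk x (q1 ++ r :: q2) -> simple io (q1 ++ r :: q2) ->
  ~~ has (mem (edges io (q1 ++ r :: q2))) p1 ->
  trail (p1 ++ r :: q2) /\ sfin x0 (p1 ++ r :: q2) = sfin x (q1 ++ r :: q2).
Proof.
move=> T wq sq dis; have sT := trail_sub T; have sQ := walk_sub wq.
have [T1 f1 _] := trail_mid T; have [w1 s1] := andP T1.
have s2 := simple_suffix sQ sq.
move: (wq); rewrite walk_cat /= => /and4P[_ rF dr w2].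
have sp1 : {subset p1 <= F} by apply: trail_sub.
have srq : {subset r :: q2 <= F} by move=> k kq; apply: sQ; rewrite mem_cat kq orbT.
split; last by rewrite !fin_cat.
rewrite /trail walk_cat w1 /= rF f1 eqxx w2 /=.
rewrite (simple_cat wfF) // s1 s2 has_edgesC //=.
apply: contra dis => /hasP[k kp1 /= kq]; apply/hasP; exists k => //=.
by rewrite (perm_mem (edges_cat io _ _)) mem_cat kq orbT.
Qed.

(* A trail reaching [x] and a simple walk from [x] that cross are spliced at the
   first crossing, where the walk may be followed in either direction. *)
Lemma splice p q x y : trail p -> sfin x0 p = x ->
  swalk x q -> simple io q -> sfin x q = y ->
  exists r, [/\ trail r, {subset edges io r <= edges io p ++ edges io q} &
    sfin x0 r = y \/ sfin x0 r = bar x].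
Proof.
move=> T fp wq sq fq; have sT := trail_sub T; have sQ := walk_sub wq.
have [w1 s1] := andP T.
have [|dis] := boolP (has (mem (edges io q)) p); last first.
  exists (p ++ q); split.
  - by rewrite /trail walk_cat w1 fp wq (simple_cat wfF) // s1 sq has_edgesC.
  - by move=> k; rewrite (perm_mem (edges_cat io _ _)).
  - by left; rewrite fin_cat fp.
move/has_split=> [p1 [r [p2 [E rq n1]]]]; rewrite E in T.
have rF : r \in F by apply: sT; rewrite E mem_cat inE eqxx orbT.
have key z u q' : perm_eq (edges io q') (edges io q) -> swalk z q' -> simple io q' ->
    sfin z q' = u -> r \in q' -> exists r', [/\ trail r',
    {subset edges io r' <= edges io p ++ edges io q} & sfin x0 r' = u].
  move=> pq wq' sq' fq' /splitPr rq'; case: rq' pq wq' sq' fq' => q1 q2 pq wq' sq' fq'.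
  have n1' : ~~ has (mem (edges io (q1 ++ r :: q2))) p1.
    by rewrite (eq_has (a2 := mem (edges io q))) // => k /=; rewrite (perm_mem pq).
  have [T' f'] := splice_at T wq' sq' n1'.
  exists (p1 ++ r :: q2); split=> //; last by rewrite f'.
  move=> k; rewrite (perm_mem (edges_cat io _ _)) mem_cat => /orP[kp|kq].
    by rewrite mem_cat E (perm_mem (edges_cat io _ _)) mem_cat kp.
  rewrite mem_cat; apply/orP; right.
  by rewrite -(perm_mem pq) (perm_mem (edges_cat io _ _)) mem_cat kq orbT.
move: rq; rewrite /= (mem_edges wfF sQ rF) => /orP[rq|rq].
  by have [r' [T' e' f']] := key x y q (perm_refl _) wq sq fq rq; exists r'; split=> //; left.
have [wr fr] := swalk_rev wfF wq.
have [|||r' [T' e' f']] := key _ _ (rev_walk io q) _ wr _ fr.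
- apply: uniq_perm; [by rewrite -/(simple _ _) (simple_rev wfF) | exact: sq |].
  move=> k; have [kF|kF] := boolP (k \in F).
    rewrite (mem_edges wfF (rev_walk_sub wfF sQ) kF) (mem_edges wfF sQ kF).
    by rewrite !(mem_rev_walk wfF) ?(io_in wfF) // (ioK wfF) // orbC.
  apply/idP/idP => /(edges_sub wfF) k'; move: kF; rewrite k' //.
  exact: rev_walk_sub.
- by rewrite (simple_rev wfF).
- by rewrite (mem_rev_walk wfF).
by exists r'; split=> //; right.
Qed.

(** Reversing the edges of the trail turns its excess at [v] from -2 into 2. *)
Lemma trail_flip v p : trail p -> x0 = (v, true) -> sfin x0 p = (v, false) ->
  exists g', compat io F g' g /\ forall w,
    excess nu F (fun h => sg (g' h)) w =
    excess nu F (fun h => sg (g h)) w + (if w == v then 4 else 0).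
Proof.
move=> T E0 fp; have sT := trail_sub T; have [wp sp] := andP T.
exists (fun h => g h (+) (h \in edges io p)); split.
  move=> h hF; rewrite (edges_io wfF) //.
  by case: (g h); case: (g (io h)); case: (_ \in _).
move=> w; rewrite (@eq_excess _ _ nu F _ (fun h => sg (g h) +
  (- 2%:Z) * (sg (g h) * (h \in edges io p)%:Z))); last first.
  by move=> h _; case: (g h); case: (_ \in _).
rewrite excessD excessZ; congr (_ + _).
suff -> : excess nu F (fun h => sg (g h) * (h \in edges io p)%:Z) w =
    if w == v then -2 else 0 by case: ifP.
rewrite /excess (sum_mem (fun h => nu h == w) (fun h => sg (g h)) sp (edges_sub wfF sT)).
rewrite /edges big_cat big_map /= -big_split /= (sum_swalk w wp) fp E0 /= eq_sym.
by case: eqP.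
Qed.

End Trails.

(** * Edge cuts *)

Section Cuts.
Variables (H V : finType) (nu : H -> V) (io : H -> H) (F : {set H}).
Hypothesis wfF : wf io F.
Implicit Types (X Y Z : {set V}).

Notation bd := (boundary nu io F).

Lemma card_bd Y : #|bd Y| = (\sum_(h in F) ((nu h \in Y) && (nu (io h) \notin Y)))%N.
Proof.
rewrite -sum1_card big_mkcond [RHS]big_mkcond; apply: eq_bigr => h _.
by rewrite inE; case: (h \in F) => //=; case: (_ && _).
Qed.

Lemma card_bdC Y : #|bd (~: Y)| = #|bd Y|.
Proof.
have sub Z : (#|bd (~: Z)| <= #|bd Z|)%N.
  rewrite -(card_in_imset (f := io) (D := bd (~: Z))); last first.
    move=> h k; rewrite !inE => /and3P[hF _ _] /and3P[kF _ _] /(congr1 io).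
    by rewrite !(ioK wfF).
  apply/subset_leq_card/subsetP => k /imsetP[h]; rewrite !inE negbK.
  by move=> /and3P[hF h1 h2] ->; rewrite (io_in wfF) // (ioK wfF) // h2 h1.
by apply/eqP; rewrite eqn_leq sub -{1}(setCK Y) sub.
Qed.

(** Each half-edge satisfies the inequality by itself. *)
Lemma bd_submod Y Z : (#|bd (Y :&: Z)| + #|bd (Y :|: Z)| <= #|bd Y| + #|bd Z|)%N.
Proof.
rewrite !card_bd -!big_split /=; apply: leq_sum => h _; rewrite !inE.
by case: (nu h \in Y); case: (nu h \in Z); case: (nu (io h) \in Y); case: (nu (io h) \in Z).
Qed.

Lemma bd_posimod Y Z : (#|bd (Y :\: Z)| + #|bd (Z :\: Y)| <= #|bd Y| + #|bd Z|)%N.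
Proof.
rewrite -(card_bdC Z) -(card_bdC (Z :\: Y)) setDE setCD [~: Z :|: Y]setUC.
exact: bd_submod.
Qed.

(** The degrees in [Y] have an even sum, in which the edges inside [Y] count twice. *)
Lemma even_card_bd Y : even_deg nu F -> ~~ odd #|bd Y|.
Proof.
move=> evF; pose I := [set h in F | (nu h \in Y) && (nu (io h) \in Y)].
have evI : ~~ odd #|I|.
  apply: (even_closed wfF) => [|h]; first by apply/subsetP => h; rewrite inE => /andP[].
  by rewrite !inE => /and3P[hF h1 h2]; rewrite (io_in wfF) // (ioK wfF) // h2 h1.
have E : #|side nu F Y| = (#|I| + #|bd Y|)%N.
  rewrite -(cardsID [set h | nu (io h) \in Y] (side nu F Y)).
  congr (_ + _)%N; apply: eq_card => h; rewrite !inE;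
    by case: (h \in F); case: (nu h \in Y); case: (nu (io h) \in Y).
have evP : ~~ odd #|side nu F Y|.
  have -> : #|side nu F Y| = (\sum_(w in Y) #|halves nu F w|)%N.
    rewrite -sum1_card (partition_big nu (mem Y)) /=; last by move=> h; rewrite inE => /andP[].
    apply: eq_bigr => w wY; rewrite -sum1_card; apply: eq_bigl => h.
    by rewrite !inE; case: eqP => [->|]; rewrite ?wY ?andbT ?andbF.
  by elim/big_rec: _ => // w n _ ev; rewrite oddD negb_add (negPf (evF w)) (negPf ev).
by move: evP; rewrite E oddD (negPf evI).
Qed.

Lemma bd0_closed Y h0 : connected_halves nu io F -> bd Y = set0 -> h0 \in F -> nu h0 \in Y ->
  forall h, h \in F -> nu h \in Y.
Proof.
move=> connF bd0 h0F h0Y; apply: (connF Y); last by exists h0.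
move=> h hF hY; apply: contraT => ihY.
by have := in_set0 h; rewrite -bd0 inE hF hY ihY.
Qed.

(** An inner edge with a half outside [E] cancels, and each remaining half-edge contributes at most
    1 in absolute value. *)
Lemma bound_signed Y (t : H -> bool) (E : {set H}) :
  (forall h, h \in F -> nu h \in Y -> nu (io h) \in Y -> h \notin E -> t h != t (io h)) ->
  `|\sum_(h in F | nu h \in Y) sg (t h)| <= #|E|%:Z + #|bd Y|%:Z.
Proof.
move=> tE; rewrite (sum_boundary nu io).
apply: le_trans (ler_normD _ _) _; apply: lerD; last first.
  apply: le_trans (ler_norm_sum _ _ _) _.
  rewrite -[leRHS]natz -[_%:R]/(1 *+ _) -sumr_const; apply: ler_sum => h _.
  by case: (t h).
set S := \sum_(h in F | _) _.
have SS : S + S = \sum_(h in F | (nu h \in Y) && (nu (io h) \in Y)) (sg (t h) + sg (t (io h))).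
  rewrite big_split /=; congr (_ + _); rewrite /S (sum_io wfF).
  by apply: eq_bigl => h; case: (boolP (h \in F)) => //= hF; rewrite (ioK wfF hF) andbC.
have : `|S + S| <= \sum_(h in E) 2%:Z.
  rewrite SS; apply: le_trans (ler_norm_sum _ _ _) _.
  rewrite big_mkcond [leRHS]big_mkcond; apply: ler_sum => h _.
  case: ifP => [/and3P[hF h1 h2]|_]; last by case: ifP.
  case: ifP => [_|/negbT hE]; first by case: (t h); case: (t (io h)).
  by have := tE h hF h1 h2 hE; case: (t h); case: (t (io h)).
rewrite sumr_const -mulr_natr natz.
by move: (S) (Posz #|E|) => s e; lia.
Qed.

End Cuts.

(** * Labels of the vertices when no alternating trail returns *)

Section Structure.
Variables (H V : finType) (nu : H -> V) (io : H -> H) (F : {set H}).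
Variables (g : H -> bool) (v : V).
Hypotheses (wfF : wf io F) (connF : connected_halves nu io F) (evF : even_deg nu F).
Hypothesis exg : forall w, excess nu F (fun h => sg (g h)) w = if w == v then 2 else 0.
Hypothesis no_return : ~ reach nu io F g (v, true) (v, false).
Hypothesis no_2cut : forall Y, #|boundary nu io F Y| != 2%N.
Implicit Types (p q : seq H) (h k : H) (u w : V) (X Y : {set V}).

Notation bd := (boundary nu io F).
Notation trl := (trail nu io F g (v, true)).
Notation rch := (reach nu io F g (v, true)).
Notation sfin := (endpoint (snx nu io g)).
Notation dep := (sdep nu g).
Notation nx := (snx nu io g).

Definition label w b : bool := `[< rch (w, b) >].
Definition one_label w := label w true (+) label w false.
Definition both_labels w := label w true && label w false.
Definition lab w := label w true.
(** At a vertex with one label, [lab] is that label, and a half-edge that disagrees is one through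
    which a trail arriving with this label may leave. *)
Definition agrees h := g h == lab (nu h).

Lemma labelP w b : reflect (rch (w, b)) (label w b). Proof. exact: asboolP. Qed.

Lemma one_label_lab w : one_label w -> label w (lab w) /\ label w (~~ lab w) = false.
Proof. by rewrite /one_label /lab; case l: (label w true); case l': (label w false); rewrite ?l ?l'. Qed.

Lemma root_label : label v true.
Proof. by apply/labelP; exists [::]. Qed.

Lemma root_single : one_label v /\ lab v.
Proof.
rewrite /lab /one_label root_label; split=> //=.
by apply/negP => /labelP.
Qed.

(* A trail to the tail state of [h] either extends through [h] or has already used
   its edge, in one of the two directions. *)
Lemma reach_cases h : h \in F -> rch (dep h) ->
  rch (nx h) \/ (rch (dep (io h)) /\ rch (nx (io h))).
Proof.
move=> hF [p [T fp]]; have sp := trail_sub T.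
have mid k : k \in p -> rch (dep k) /\ rch (nx k).
  move=> /splitPr kp; case: kp T fp sp => p1 p2 T _ _.
  have [T1 f1 T2] := trail_mid wfF T.
  by split; [exists p1 | exists (rcons p1 k); rewrite fin_rcons].
have [|hp] := boolP (h \in edges io p).
  rewrite (mem_edges wfF sp hF) => /orP[/mid[]|/mid[]]; first by left.
  by right.
left; exists (rcons p h); split; last by rewrite fin_rcons.
by apply: (trail_rcons wfF).
Qed.

Lemma dep_io h : h \in F -> dep (io h) = bar (nx h).
Proof. by []. Qed.

Lemma nx_io h : h \in F -> nx (io h) = bar (dep h).
Proof. by move=> hF; rewrite /snx /bar /= (ioK wfF hF) negbK. Qed.

(** If the edge of [h] had been used backwards instead, [nu h] would carry the opposite label
    too. *)
Lemma disagree_step h : h \in F -> one_label (nu h) -> ~~ agrees h -> rch (nx h).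
Proof.
move=> hF sh ah; have [l1 l2] := one_label_lab sh.
have rd : rch (dep h).
  move: ah l1; rewrite /agrees /sdep => ah /labelP.
  by have -> : lab (nu h) = ~~ g h by move: ah; case: (g h); case: (lab _).
have [//|[_]] := reach_cases hF rd.
rewrite (nx_io hF) /bar /= negbK => r2.
suff : label (nu h) (~~ lab (nu h)) by rewrite l2.
apply/labelP; move: ah r2; rewrite /agrees.
by case: (g h); case: (lab _).
Qed.

(** Leaving through a disagreeing [h] arrives at the other end with sign [g (io h)], which is then
    its only label. *)
Lemma one_label_pair h : h \in F -> one_label (nu h) -> one_label (nu (io h)) ->
  agrees h || agrees (io h).
Proof.
move=> hF sh sih; case ah: (agrees h) => //=.
have := disagree_step hF sh (negbT ah); rewrite /snx => /labelP l.
have [l1 l2] := one_label_lab sih; rewrite /agrees; move: l l2.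
by case: (g (io h)); case: (lab _) => // ->.
Qed.

Lemma both_labels_step h : h \in F -> both_labels (nu h) ->
  one_label (nu (io h)) || both_labels (nu (io h)).
Proof.
move=> hF /andP[l1 l2].
have rd : rch (dep h) by rewrite /sdep; case: (g h); apply/labelP.
suff [b] : exists b, label (nu (io h)) b.
  by rewrite /one_label /both_labels; case: b => ->; case: (label _ _).
have [r|[r _]] := reach_cases hF rd.
  by exists (g (io h)); apply/labelP.
by exists (~~ g (io h)); apply/labelP.
Qed.

(** The edges by which trails pass from a vertex with one label to a vertex with both. *)
Definition entry h := [&& h \in F, one_label (nu h), both_labels (nu (io h)) & ~~ agrees h].

Section Entry.
Variable h : H.
Hypothesis eh : entry h.

Let hF : h \in F. Proof. by case/and4P: eh. Qed.

(** Traversing [h] backwards would give [nu h] its second label. *)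
Lemma entry_not_io p : trl p -> io h \notin p.
Proof.
case/and4P: eh => _ sh dh ah T; apply/negP => /splitPr ip; case: ip T => p1 p2 T.
have [_ _ T2] := trail_mid wfF T; have [l1 l2] := one_label_lab sh.
suff : label (nu h) (~~ lab (nu h)) by rewrite l2.
apply/labelP; exists (rcons p1 (io h)); split=> //.
rewrite fin_rcons (nx_io hF) /bar /= negbK; congr (_, _).
by move: ah; rewrite /agrees; case: (g h); case: (lab _).
Qed.

Lemma entry_edges p : trl p -> h \notin p -> h \notin edges io p.
Proof.
move=> T hp; rewrite (mem_edges wfF (trail_sub T) hF) negb_or hp.
exact: entry_not_io.
Qed.

(** Otherwise the trail could be continued through [io h]. *)
Lemma entry_dep p : trl p -> sfin (v, true) p = dep (io h) -> h \in p.
Proof.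
move=> T fp; apply: contraT => hp.
have ihF := io_in wfF hF.
have T' : trl (rcons p (io h)).
  apply: (trail_rcons wfF) => //.
  by rewrite (edges_io wfF (trail_sub T)) // entry_edges.
by have := entry_not_io T'; rewrite mem_rcons inE eqxx.
Qed.

Lemma entry_tail q w b : trl q -> sfin (v, true) q = (w, b) -> h \in q ->
  exists q', [/\ walk dep nx F (nx h) q', simple io q', sfin (nx h) q' = (w, b) &
    h \notin edges io q'].
Proof.
move=> T fq /splitPr hq; case: hq T fq => q1 q2 T fq.
have s := trail_sub T; case/andP: (T) => wq sq.
move: (wq); rewrite walk_cat /= => /and4P[_ _ _ w2].
have := simple_suffix wfF s sq.
have s2 : {subset q2 <= F} by move=> k kq; apply: s; rewrite mem_cat inE kq !orbT.
rewrite -cat1s (simple_cat wfF) //; last by move=> k; rewrite inE => /eqP->.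
move=> /and3P[s1' s2' dis]; exists q2; split=> //.
  by rewrite -fq fin_cat.
have := dis; rewrite (has_edgesC wfF) //=; last by move=> k; rewrite inE => /eqP->.
by rewrite orbF.
Qed.

(* The component of [nu (io h)] is a blossom whose base is [h]. *)
Lemma entry_head p b : trl p -> sfin (v, true) p = (nu (io h), b) -> h \in p.
Proof.
move=> T fp; apply: contraT => hp.
have [E|E] : (b = ~~ g (io h)) \/ (b = g (io h)) by case: (b); case: (g _); auto.
  by move: hp; rewrite (entry_dep T) // fp E.
case/and4P: eh => _ _ /andP[l1 l2] _.
(* Both outcomes of [splice] end in [dep (io h)], so the spliced trail uses [h]; yet it is made from
   [p] and from a tail that starts after [h]. *)
have [q [Tq fq]] : rch (dep (io h)) by rewrite /sdep; case: (g (io h)); apply/labelP.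
have [q' [wq' sq' fq' hq']] := entry_tail Tq fq (entry_dep Tq fq).
have [|r [Tr er fr]] := splice wfF T _ wq' sq' fq'; first by rewrite fp E.
have : h \in r by case: fr => fr; apply: (entry_dep Tr); rewrite fr // dep_io.
move=> hr; have : h \in edges io r by rewrite mem_cat hr.
by move/er; rewrite mem_cat (negPf hq') (negPf (entry_edges T hp)).
Qed.

(** A trail using the edge of [k] visits [nu k] and so contains [h]; one ending in [dep (io k)]
    either does so or extends to [nu k]. A trail to [nx k] avoiding [h] is spliced with the reversal
    of a tail from [h] to [dep (io k)], which gives a trail avoiding [h] in one of the cases already
    settled. *)
Lemma entry_spread k : k \in F -> both_labels (nu k) -> both_labels (nu (io k)) ->
  (forall p b, trl p -> sfin (v, true) p = (nu k, b) -> h \in p) ->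
  forall p b, trl p -> sfin (v, true) p = (nu (io k), b) -> h \in p.
Proof.
move=> kF dk dik IH p b T fp; apply: contraT => hp.
have sp := trail_sub T; have ihF := io_in wfF kF.
have nodouble : ~~ both_labels (nu h).
  by case/and4P: eh => _; rewrite /one_label /both_labels; case: (label _ _); case: (label _ _).
have through q : trl q -> k \in edges io q -> h \in q.
  move=> Tq; rewrite (mem_edges wfF (trail_sub Tq) kF) => /orP[]/splitPr kq.
    case: kq Tq => q1 q2 Tq; have [T1 f1 _] := trail_mid wfF Tq.
    by rewrite mem_cat (IH _ _ T1 f1).
  case: kq Tq => q1 q2 Tq; have [_ _ T2] := trail_mid wfF Tq.
  have : h \in rcons q1 (io k).
    by apply: (IH _ (g k) T2); rewrite fin_rcons (nx_io kF) /bar /= negbK.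
  by rewrite -cat_rcons mem_cat => ->.
have noext q : trl q -> sfin (v, true) q = dep (io k) -> h \in q.
  move=> Tq fq; have [/through->//|kq] := boolP (k \in edges io q).
  have T' : trl (rcons q (io k)).
    apply: (trail_rcons wfF) => //.
    by rewrite (edges_io wfF (trail_sub Tq)).
  have : h \in rcons q (io k).
    by apply: (IH _ (g k) T'); rewrite fin_rcons (nx_io kF) /bar /= negbK.
  rewrite mem_rcons inE => /orP[/eqP E|//].
  by move: nodouble; rewrite E dik.
have Eb : b = g (io k).
  apply/eqP; apply: contraT => nb; rewrite (noext p) // in hp.
  by rewrite fp /sdep; congr (_, _); move: nb; case: (b); case: (g _).
case/andP: (dik) => l1 l2.
have [q [Tq fq]] : rch (dep (io k)) by rewrite /sdep; case: (g (io k)); apply/labelP.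
have [q' [wq' sq' fq' hq']] := entry_tail Tq fq (noext q Tq fq).
have [wr frv] := swalk_rev wfF wq'; have sq's := walk_sub wq'.
have fpE : sfin (v, true) p = bar (sfin (nx h) q').
  by rewrite fp fq' Eb /bar /= negbK.
have sr : simple io (rev_walk io q') by rewrite (simple_rev wfF).
have [r [Tr er fr]] := splice wfF T fpE wr sr frv.
have : h \in r.
  case: fr => fr; first by apply: (entry_head Tr); rewrite fr.
  by apply: (noext r Tr); rewrite fr barK fq'.
move=> hr; have : h \in edges io r by rewrite mem_cat hr.
move/er; rewrite mem_cat (negPf (entry_edges T hp)) /=.
rewrite (mem_edges wfF (rev_walk_sub wfF sq's) hF) !(mem_rev_walk wfF) ?(io_in wfF) //.
by rewrite (ioK wfF) // orbC -(mem_edges wfF sq's hF) (negPf hq').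
Qed.

End Entry.
Definition dadj u w := [exists k in F, [&& nu k == u, nu (io k) == w, both_labels u & both_labels w]].
Definition comp h := [set w | connect dadj (nu (io h)) w].

Lemma dadj_sym : symmetric dadj.
Proof.
suff imp u w : dadj u w -> dadj w u by move=> u w; apply/idP/idP; apply: imp.
move=> /existsP[k /and5P[kF /eqP<- /eqP<- d1 d2]]; apply/existsP; exists (io k).
by rewrite (io_in wfF) // (ioK wfF) // !eqxx d1 d2.
Qed.

Lemma comp_spec h w : entry h -> w \in comp h ->
  both_labels w /\ forall p b, trl p -> sfin (v, true) p = (w, b) -> h \in p.
Proof.
move=> eh; rewrite inE => /connectP[s]; elim/last_ind: s w => [|s u IH] w /=.
  move=> _ ->; split; first by case/and4P: eh.
  by move=> p b; apply: entry_head.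
rewrite rcons_path last_rcons => /andP[ps adj] ->.
have [_ IH'] := IH _ ps erefl.
case/existsP: adj => k /and5P[kF /eqP kE /eqP <- d1 d2]; split=> //.
apply: (entry_spread eh kF) => //; first by rewrite kE.
by rewrite kE.
Qed.

Lemma comp_bd h k : entry h -> k \in F -> nu k \in comp h ->
  nu (io k) \notin comp h -> one_label (nu (io k)).
Proof.
move=> eh kF kc ikc; have [dk _] := comp_spec eh kc.
case/orP: (both_labels_step kF dk) => // dik; case/negP: ikc.
move: kc; rewrite !inE => kc; apply: connect_trans kc _; apply: connect1.
by apply/existsP; exists k; rewrite kF !eqxx dk dik.
Qed.

(** On a trail into a common component each of two distinct entries would have to precede the
    other. *)
Lemma comp_disjoint h h' w : entry h -> entry h' -> w \in comp h -> w \in comp h' ->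
  h = h'.
Proof.
move=> eh eh' wh wh'.
have symc := sym_connect_sym dadj_sym.
have c1 : nu (io h) \in comp h by rewrite inE connect0.
have c2 : nu (io h') \in comp h.
  move: wh wh'; rewrite !inE => wh; rewrite symc; exact: connect_trans.
have c3 : nu (io h) \in comp h'.
  move: wh wh'; rewrite !inE => wh wh'; apply: connect_trans wh' _; by rewrite symc.
have [_ P] := comp_spec eh c1; have [_ P'] := comp_spec eh' c3.
have [_ P2] := comp_spec eh c2.
have [p [T fp]] : rch (nu (io h), true).
  by case/and4P: eh => _ _ /andP[/labelP].
have hp := P _ _ T fp; have hp' := P' _ _ T fp.
apply/eqP; apply: contraT => ne.
case/splitPr: hp T fp hp' => p1 p2 T fp hp'.
have [_ _ T1] := trail_mid wfF T.
have h1 : h \notin p1.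
  case/andP: T => _; rewrite /simple cat_uniq => /andP[].
  by rewrite cat_uniq /= negb_or => /and3P[_ /andP[]].
have h'p1 : h' \in p1.
  have := P' _ (g (io h)) T1; rewrite fin_rcons mem_rcons inE => /(_ erefl).
  by rewrite eq_sym (negPf ne).
case/splitPr: h'p1 T1 h1 => p3 p4 T1 h1.
have T3 : trl (rcons p3 h').
  by move: T1; rewrite -cats1 -catA => /(trail_mid wfF)[].
have := P2 _ (g (io h')) T3; rewrite fin_rcons mem_rcons inE => /(_ erefl).
by rewrite (negPf ne) /= => h3; case/negP: h1; rewrite mem_cat h3.
Qed.

Definition both_agree := [set h in F | [&& one_label (nu h), one_label (nu (io h)), agrees h & agrees (io h)]].
Definition one_labelled := [set w | one_label w].

(** The cut has even size, different from 2, and is not empty because [nu h], with one label, lies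
    outside. *)
Lemma card_bd_comp h : entry h -> (4 <= #|bd (comp h)|)%N.
Proof.
move=> eh; have := no_2cut (comp h); have := even_card_bd wfF (comp h) evF.
suff : #|bd (comp h)| != 0%N by move: #|bd (comp h)| => n; lia.
rewrite cards_eq0; apply/eqP => bd0.
have hF : h \in F by case/and4P: eh.
have c1 : nu (io h) \in comp h by rewrite inE connect0.
have c2 : nu h \in comp h := bd0_closed connF bd0 (io_in wfF hF) c1 hF.
have [] := comp_spec eh c2; case/and4P: eh => _.
by rewrite /one_label /both_labels; case: (label _ _); case: (label _ _).
Qed.

(** Beyond a disagreeing boundary half-edge lies a vertex that is reached and does not have just one
    label, so it has both. *)
Lemma entry_bd h : (entry h) = (h \in bd one_labelled) && ~~ agrees h.
Proof.
rewrite /entry !inE; case hF: (h \in F) => //=; case sh: (one_label (nu h)) => //=.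
case ah: (agrees h); rewrite ?andbF ?andbT //=.
have := disagree_step hF sh (negbT ah); rewrite /snx => /labelP.
rewrite /both_labels /one_label; case: (g (io h)) => ->; by case: (label _ _).
Qed.

(* Each component is entered once and has at least four boundary edges. *)
Lemma four_entries : (4 * #|[set h | entry h]| <= #|bd one_labelled|)%N.
Proof.
set M := [set h | entry h].
have step1 : (4 * #|M| <= \sum_(h in M) #|bd (comp h)|)%N.
  rewrite mulnC -sum_nat_const; apply: leq_sum => h; rewrite inE; exact: card_bd_comp.
apply: leq_trans step1 _.
(* A boundary edge of a component ends at a vertex with one label, so it also crosses the boundary
   of [one_labelled]. *)
have step2 : (\sum_(h in M) #|bd (comp h)| <=
    \sum_(h in M) \sum_(k in bd one_labelled) (nu (io k) \in comp h))%N.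
  apply: leq_sum => h; rewrite inE => eh.
  have inj : {in bd (comp h) &, injective io}.
    by apply: (can_in_inj (g := io)) => k; rewrite inE => /andP[/(ioK wfF)].
  rewrite -(card_in_imset inj) -sum1_card big_mkcond [leqRHS]big_mkcond /=.
  apply: leq_sum => k _; case: ifP => // /imsetP[k']; rewrite inE => /and3P[kF kc ikc] ->.
  have sk := comp_bd eh kF kc ikc; have [dk _] := comp_spec eh kc.
  rewrite !inE (io_in wfF) // (ioK wfF) // sk.
  have -> : one_label (nu k') = false.
    by move: dk; rewrite /one_label /both_labels; case: (label _ _); case: (label _ _).
  by move: kc; rewrite inE => ->.
apply: leq_trans step2 _.
(* Components of distinct entries are disjoint, so no boundary edge is counted twice. *)
rewrite exchange_big /= -sum1_card; apply: leq_sum => k _.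
have [[h /andP[hM kc]]|none] := pselect (exists h, (h \in M) && (nu (io k) \in comp h)).
  rewrite (bigD1 h) //= kc big1 // => h' /andP[h'M ne].
  case kc': (_ \in comp h') => //; case/eqP: ne.
  by move: hM h'M; rewrite !inE => eh eh'; apply: comp_disjoint kc' kc.
rewrite big1 // => h hM; case kc: (_ \in comp h) => //; case: none.
by exists h; rewrite hM kc.
Qed.

(** The signed excess over [one_labelled] is 2. Inner edges contribute [#|both_agree|]; on the
    boundary agreeing half-edges count 1 and the disagreeing ones, the entries, -1. *)
Lemma count_structure : (#|both_agree| + #|bd one_labelled| = 2 + 2 * #|[set h | entry h]|)%N.
Proof.
have [sv lv] := root_single.
have S2 : \sum_(w in one_labelled) sg (lab w) * excess nu F (fun h => sg (g h)) w = 2.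
  rewrite (bigD1 v) ?inE //= lv exg eqxx big1 ?addr0 ?mul1r //.
  by move=> w /andP[_ /negPf wv]; rewrite exg wv mulr0.
move: S2; rewrite -sum_signed (sum_boundary nu io) sum_inner //; last first.
  by move=> h hF; rewrite !inE; apply: one_label_pair.
have -> : [set h in F | [&& nu h \in one_labelled, nu (io h) \in one_labelled,
    g h == lab (nu h) & g (io h) == lab (nu (io h))]] = both_agree.
  by apply/setP => h; rewrite !inE.
have -> : \sum_(h in bd one_labelled) sg (g h == lab (nu h)) =
    #|bd one_labelled|%:Z - 2 * #|[set h | entry h]|%:Z.
  rewrite (eq_bigr (fun h => 1 + (- 2%:Z) * (entry h)%:Z)); last first.
    by move=> h hb; rewrite entry_bd hb /agrees; case: (_ == _).
  rewrite big_split /= -mulr_sumr mulNr; congr (_ - 2 * _).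
    by rewrite sumr_const natz.
  rewrite -[RHS]natz -[_%:R]/(1 *+ _) -sumr_const big_mkcond [RHS]big_mkcond.
  apply: eq_bigr => h _; have -> : (h \in [set h | entry h]) = entry h by rewrite inE.
  by rewrite entry_bd; case: (h \in bd one_labelled) => //=; case: (agrees h).
by lia.
Qed.

(** With [b] boundary edges, [m] entries and [c] the cardinal of [both_agree], the counts give
    [c + b = 2 + 2 * m] and [4 * m <= b], so [b <= 4]; as [b] is even and not 2, two cases
    remain. *)
Lemma reachability_structure : exists (X : {set V}) (s : V -> bool) (c : nat), [/\ v \in X,
  (#|bd X| = 0 /\ c = 2 \/ #|bd X| = 4 /\ c = 0)%N &
  forall (g0 : H -> bool) Y, compat io F g0 g -> Y \subset X ->
   `|\sum_(h in F | nu h \in Y) sg (g0 h == s (nu h))| <= c%:Z + #|bd Y|%:Z].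
Proof.
have [sv lv] := root_single.
exists one_labelled, lab, #|both_agree|; split; first by rewrite inE.
  have := count_structure; have := four_entries.
  have := no_2cut one_labelled; have := even_card_bd wfF one_labelled evF.
  by move: #|bd one_labelled| #|both_agree| #|[set h | entry h]| => a b c; lia.
move=> g0 Y C YX; apply: bound_signed => // h hF hY ihY hA.
have := subsetP YX _ hY; have := subsetP YX _ ihY; rewrite !inE => sih sh.
have := one_label_pair hF sh sih; move: hA; rewrite inE hF sh sih /= /agrees.
have := C h hF.
by case: (g h); case: (g0 h); case: (g (io h)); case: (g0 (io h));
  case: (lab _); case: (lab _).
Qed.

End Structure.

(** * Uncrossing *)

Section Family.
Variables (H V : finType) (nu : H -> V) (io : H -> H) (F : {set H}) (a : H -> int).
Hypotheses (wfF : wf io F) (connF : connected_halves nu io F).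
Implicit Types (X Y Z : {set V}) (P : seq {set V}).

Notation bd := (boundary nu io F).
Notation prt := (side nu F).

Definition dsum Y : int := \sum_(h in prt Y) a h.

Hypothesis even_dsum : forall Y, (2 %| dsum Y)%Z.
Hypothesis odd_total : ~~ (4 %| \sum_(h in F) a h)%Z.
Hypothesis no_small_cut : forall Y, bd Y != set0 -> (4 <= #|bd Y|)%N.

Lemma dsumE Y : dsum Y = \sum_(h in F) if nu h \in Y then a h else 0.
Proof. by rewrite /dsum sum_part big_mkcondr. Qed.

Lemma dsumUI Y Z : dsum (Y :|: Z) + dsum (Y :&: Z) = dsum Y + dsum Z.
Proof.
rewrite !dsumE -!big_split /=; apply: eq_bigr => h _; rewrite !inE.
by case: (nu h \in Y); case: (nu h \in Z); rewrite ?addr0 ?add0r.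
Qed.

Lemma dsumD Y Z : dsum (Y :\: Z) + dsum (Y :&: Z) = dsum Y.
Proof.
rewrite !dsumE -!big_split /=; apply: eq_bigr => h _; rewrite !inE.
by case: (nu h \in Y); case: (nu h \in Z); rewrite ?addr0 ?add0r.
Qed.

Lemma dsum_part0 Y : prt Y = set0 -> dsum Y = 0.
Proof. by move=> E; rewrite /dsum E big_set0. Qed.

Lemma dsum_partT Y : (forall h, h \in F -> nu h \in Y) -> dsum Y = \sum_(h in F) a h.
Proof.
move=> E; apply: eq_bigl => h; rewrite inE.
by case: (boolP (h \in F)) => // /E.
Qed.

Lemma bd_cases Y : [\/ prt Y = set0, forall h, h \in F -> nu h \in Y | (4 <= #|bd Y|)%N].
Proof.
have [bd0|/no_small_cut] := eqVneq (bd Y) set0; last by constructor 3.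
have [|[h]] := set_0Vmem (prt Y); first by constructor 1.
by rewrite inE => /andP[hF hY]; constructor 2; apply: bd0_closed connF bd0 hF hY.
Qed.

Definition even4 Z : Prop := #|bd Z| = 4%N /\ (4 %| dsum Z)%Z.
(** Controlling all subsets with a small cut, and not [X] alone, is what lets uncrossing pass to
    [X :\: Z]. *)
Definition tight X : Prop := #|bd X| = 4%N /\
  forall Y, Y \subset X -> (#|bd Y| <= 4)%N -> (4 %| dsum Y)%Z.

Lemma tight_even4 X : tight X -> even4 X.
Proof. by case=> b4 E; split=> //; apply: E; rewrite ?b4. Qed.

(** If the sum over the intersection were not divisible by 4, neither would those over the two
    differences be, so each is cut off by at least 4 edges. Posimodularity makes both cuts exactly
    4, and tightness of [X] is contradicted by [X :\: Z]. *)
Lemma tight_inter X Z : tight X -> even4 Z -> (4 %| dsum (X :&: Z))%Z.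
Proof.
move=> tX [bZ dZ]; have [bX dX] := tight_even4 tX; apply: contraT => ndI.
have E1 := dsumD X Z; have := dsumD Z X; rewrite setIC => E2.
have ev := even_dsum (X :&: Z); have ev1 := even_dsum (X :\: Z).
have nd1 : ~~ (4 %| dsum (X :\: Z))%Z.
  by move: E1 dX ndI; move: (dsum _) (dsum _) (dsum _) => p q r; lia.
have nd2 : ~~ (4 %| dsum (Z :\: X))%Z.
  by move: E2 dZ ndI; move: (dsum _) (dsum _) (dsum _) => p q r; lia.
have ge4 Y Y' : ~~ (4 %| dsum Y)%Z -> ~~ (4 %| dsum Y')%Z -> [disjoint Y & Y'] ->
    (4 <= #|bd Y|)%N.
  move=> nY nY' dis; have [/dsum_part0 E|all|//] := bd_cases Y.
    by rewrite E dvdz0 in nY.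
  have E : dsum Y' = 0.
    apply: dsum_part0; apply/setP => h; rewrite !inE; apply/andP => -[hF hY'].
    by have := disjointFr dis (all h hF); rewrite hY'.
  by rewrite E dvdz0 in nY'.
have dis : [disjoint X :\: Z & Z :\: X].
  rewrite -setI_eq0; apply/eqP/setP => w; rewrite !inE.
  by case: (w \in X); case: (w \in Z).
have b1 := ge4 _ _ nd1 nd2 dis.
have b2 : (4 <= #|bd (Z :\: X)|)%N by apply: ge4 nd2 nd1 _; rewrite disjoint_sym.
have := bd_posimod nu wfF X Z; rewrite bX bZ => le8.
have b4 : (#|bd (X :\: Z)| <= 4)%N.
  by move: b1 b2 le8; move: #|bd (X :\: Z)| #|bd (Z :\: X)| => p q; lia.
by have := tX.2 _ (subsetDl X Z) b4; rewrite (negPf nd1).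
Qed.

(** Intersection and union have sums divisible by 4, so neither carries all half-edges, and neither
    carries none. Both cuts then have at least 4 edges, while submodularity bounds their total by
    8. *)
Lemma even4_union W Z : even4 W -> even4 Z -> (4 %| dsum (W :&: Z))%Z ->
  prt (W :&: Z) != set0 -> even4 (W :|: Z).
Proof.
move=> [bW dW] [bZ dZ] dI neI.
have dU : (4 %| dsum (W :|: Z))%Z.
  have := dsumUI W Z; move: dW dZ dI.
  by move: (dsum W) (dsum Z) (dsum (W :&: Z)) (dsum (W :|: Z)) => p q r s; lia.
have notall Y : (4 %| dsum Y)%Z -> ~ (forall h, h \in F -> nu h \in Y).
  by move=> dY all; move: dY; rewrite (dsum_partT all); apply/negP.
have bI : (4 <= #|bd (W :&: Z)|)%N.
  have [E|/(notall _ dI)//|//] := bd_cases (W :&: Z).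
  by rewrite E eqxx in neI.
have bU : (4 <= #|bd (W :|: Z)|)%N.
  have [E|/(notall _ dU)//|//] := bd_cases (W :|: Z).
  case/set0Pn: neI => h; rewrite !inE => /and3P[hF hW hZ].
  by have := in_set0 h; rewrite -E !inE hF hW.
have := bd_submod nu io F W Z; rewrite bW bZ => le8; split=> //.
by move: bI bU le8; move: #|bd (W :&: Z)| #|bd (W :|: Z)| => p q; lia.
Qed.

(** Disjointness as far as half-edges are concerned. *)
Definition pdisjoint P : Prop := forall Y Z, Y \in P -> Z \in P -> Y != Z ->
  prt (Y :&: Z) = set0.

Lemma dsum_bigcup P : pdisjoint P -> (forall Z, Z \in P -> even4 Z) ->
  (4 %| dsum (\bigcup_(Z <- P) Z))%Z.
Proof.
elim: P => [|Z P IH] dP eP.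
  by rewrite big_nil dsum_part0 ?dvdz0 //; apply/setP => h; rewrite !inE andbF.
have IH' : (4 %| dsum (\bigcup_(Z <- P) Z))%Z.
  apply: IH => [Y Y' YP Y'P|Y YP]; last by apply: eP; rewrite inE YP orbT.
  by apply: dP; rewrite inE ?YP ?Y'P orbT.
rewrite big_cons; have [ZP|ZP] := boolP (Z \in P).
  have sub : Z \subset \bigcup_(Z <- P) Z.
    by apply/subsetP => w wZ; rewrite bigcup_seq; apply/bigcupP; exists Z.
  by rewrite (setUidPr sub).
have E0 : dsum (Z :&: \bigcup_(Z <- P) Z) = 0.
  apply: dsum_part0; apply/setP => h; rewrite !inE; apply/and3P => -[hF hZ].
  rewrite bigcup_seq => /bigcupP[Y YP hY].
  have := dP Z Y; rewrite !inE eqxx YP orbT => /(_ isT isT).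
  have -> : Z != Y by apply: contraNneq ZP => ->.
  by move=> /(_ isT) E; have := in_set0 h; rewrite -E !inE hF hZ hY.
have [_ dZ] : even4 Z by apply: eP; rewrite inE eqxx.
have := dsumUI Z (\bigcup_(Z <- P) Z); rewrite E0 addr0 => ->.
by rewrite rpredD.
Qed.

(** The members of [P] are absorbed one at a time. As they are disjoint, the next one meets the
    union built so far only inside [X], where [tight_inter] applies. *)
Lemma tight_union X P : tight X -> pdisjoint P -> (forall Z, Z \in P -> even4 Z) ->
  (forall Z, Z \in P -> prt (X :&: Z) != set0) ->
  even4 (X :|: \bigcup_(Z <- P) Z).
Proof.
move=> tX; elim: P => [|Z P IH] dP eP mP.
  by rewrite big_nil setU0; apply: tight_even4.
have IH' : even4 (X :|: \bigcup_(Z <- P) Z).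
  apply: IH => [Y Y' YP Y'P|Y YP|Y YP].
  - by apply: dP; rewrite inE ?YP ?Y'P orbT.
  - by apply: eP; rewrite inE YP orbT.
  - by apply: mP; rewrite inE YP orbT.
rewrite big_cons; have [ZP|ZP] := boolP (Z \in P).
  have sub : Z \subset \bigcup_(Z <- P) Z.
    by apply/subsetP => w wZ; rewrite bigcup_seq; apply/bigcupP; exists Z.
  by rewrite (setUidPr sub).
have eZ : even4 Z by apply: eP; rewrite inE eqxx.
have mZ : prt (X :&: Z) != set0 by apply: mP; rewrite inE eqxx.
rewrite setUCA setUC.
have E : prt ((X :|: \bigcup_(Z <- P) Z) :&: Z) = prt (X :&: Z).
  apply/setP => h; rewrite !inE; case hF: (h \in F) => //=.
  case hZ: (nu h \in Z); rewrite ?andbF ?andbT //.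
  apply/orP/idP => [[//|]|->]; last by left.
  rewrite bigcup_seq => /bigcupP[Y YP hY].
  have := dP Z Y; rewrite !inE eqxx YP orbT => /(_ isT isT).
  have -> : Z != Y by apply: contraNneq ZP => ->.
  by move=> /(_ isT) E; have := in_set0 h; rewrite -E !inE hF hZ hY.
apply: even4_union => //; last by rewrite E.
by rewrite /dsum E; apply: tight_inter.
Qed.

(* Maximal unions of tight sets would partition the vertices into classes of even
   [dsum], contradicting the oddness of the total. *)
Lemma not_all_tight : ~ (forall h, h \in F -> exists X, nu h \in X /\ tight X).
Proof.
move=> allT.
have [P [dP eP cP]] : exists P, [/\ pdisjoint P, forall Z, Z \in P -> even4 Z &
    forall h, h \in enum F -> exists2 Z, Z \in P & nu h \in Z].
  have : {subset enum F <= F} by move=> h; rewrite mem_enum.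
  elim: (enum F) => [|h hs IH] sF; first by exists [::].
  have [k khs|P [dP eP cP]] := IH; first by apply: sF; rewrite inE khs orbT.
  have hF : h \in F by apply: sF; rewrite inE eqxx.
  have [X [hX tX]] := allT h hF.
  (* The classes meeting the tight set [X] are merged with it into [W]; the others are kept. *)
  pose P1 := [seq Z <- P | prt (X :&: Z) != set0].
  pose P2 := [seq Z <- P | prt (X :&: Z) == set0].
  pose W := X :|: \bigcup_(Z <- P1) Z.
  have s1 Z : Z \in P1 -> Z \in P /\ prt (X :&: Z) != set0.
    by rewrite mem_filter => /andP[].
  have s2 Z : Z \in P2 -> Z \in P /\ prt (X :&: Z) = set0.
    by rewrite mem_filter => /andP[/eqP].
  have eW : even4 W.
    apply: tight_union => // [Y Z /s1[YP _] /s1[ZP _]|Z /s1[ZP _]|Z /s1[]//].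
      exact: dP.
    exact: eP.
  have dW Z : Z \in P2 -> prt (W :&: Z) = set0.
    move=> /s2[ZP XZ]; apply/setP => k; rewrite !inE; apply/and3P => -[kF].
    move=> /orP[kX|] kZ.
      by have := in_set0 k; rewrite -XZ !inE kF kX kZ.
    move: kZ => /[swap] kZ; rewrite bigcup_seq => /bigcupP[Y /s1[YP XY] kY].
    have YZ : Y != Z by apply: contraNneq XY => ->; rewrite XZ.
    by have := in_set0 k; rewrite -(dP _ _ YP ZP YZ) !inE kF kY kZ.
  exists (W :: P2); split.
  - move=> Y Z; rewrite !inE => /orP[/eqP->|YP2] /orP[/eqP->|ZP2] ne.
    + by rewrite eqxx in ne.
    + exact: dW.
    + by rewrite setIC dW.
    + by apply: dP => //; [case: (s2 _ YP2) | case: (s2 _ ZP2)].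
  - by move=> Z; rewrite inE => /orP[/eqP->//|/s2[/eP]].
  move=> k; rewrite inE => /orP[/eqP->|/cP[Z ZP kZ]].
    by exists W; rewrite !inE ?eqxx ?hX.
  have [ZX|ZX] := eqVneq (prt (X :&: Z)) set0.
    by exists Z; rewrite // inE mem_filter ZX eqxx ZP orbT.
  exists W; first by rewrite inE eqxx.
  rewrite inE bigcup_seq; apply/orP; right; apply/bigcupP; exists Z => //.
  by rewrite mem_filter ZX.
have := dsum_bigcup dP eP; rewrite dsum_partT; first exact/negP.
move=> h hF; have [|Z ZP hZ] := cP h; first by rewrite mem_enum.
by rewrite bigcup_seq; apply/bigcupP; exists Z.
Qed.

End Family.

(** * Orientations with excess 6 at one vertex *)

Section Core.
Variables (H V : finType) (nu : H -> V).
Implicit Types (io : H -> H) (F : {set H}) (g : H -> bool) (X Y : {set V}).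

Definition excess6 io F g : Prop := exists v g', compat io F g' g /\
  forall w, excess nu F (fun h => sg (g' h)) w = if w == v then 6 else 0.

(** An orientation compatible with [g] is a function [xi] with values 1 and -1, to which
    [extend_two_cut] applies; the extension again has values 1 and -1 and gives excess 0 beyond the
    cut. *)
Lemma excess6_lift io F Y h1 h2 g : wf io F -> connected_halves nu io F -> even_deg nu F ->
  boundary nu io F Y = [set h1; h2] -> h1 != h2 ->
  (4 %| \sum_(h in side nu F (~: Y)) sg (g h))%Z ->
  excess6 (twist io h1 h2) (side nu F Y) g -> excess6 io F g.
Proof.
move=> wfF connF evF bdY h12 sum4 [v [g' [c' ex']]].
have wfY := wf_twist wfF bdY h12.
pose xi h := sg (g' h) * sg (g h).
have [||xi' [xi'Y xi'io xi'X exX]] := extend_two_cut wfF connF evF bdY h12 (g := g) (xi := xi).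
- exact: sum4.
- by move=> h hY; apply: (compat_sg c' hY).
have xi1 h : h \in F -> xi' h = 1 \/ xi' h = -1.
  move=> hF; have [hY|hY] := boolP (nu h \in Y).
    rewrite xi'Y // /xi; case: (g' h); case: (g h); rewrite /sg; auto.
  have := xi'X h hF hY; rewrite /xi.
  have -> : `|sg (g' h1) * sg (g h1)| = 1 by case: (g' h1); case: (g h1).
  by move: (xi' h) => x; lia.
pose G h := g h (+) (xi' h == -1).
have GE h : h \in F -> sg (G h) = sg (g h) * xi' h.
  by move=> hF; rewrite /G; have [->|->] := xi1 h hF; case: (g h).
have vY : v \in Y.
  apply: contraT => vY; have := ex' v; rewrite eqxx excess_part0 //.
exists v, G; split.
  move=> h hF; rewrite /G xi'io //.
  by case: (g h); case: (g (io h)); case: (_ == _).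
move=> w; rewrite (@eq_excess _ _ nu F _ (fun h => sg (g h) * xi' h)) //.
have [wY|wY] := boolP (w \in Y); last first.
  by rewrite exX //; case: eqP wY => // ->; rewrite vY.
rewrite -(ex' w) -(@excess_part _ _ nu _ Y) //; apply: eq_excess => h.
rewrite inE => /andP[_ hY]; rewrite xi'Y // /xi.
by case: (g h); case: (g' h).
Qed.

(** From an Euler orientation with excess 2 at [nu h] a returning trail would produce excess 6, so
    [reachability_structure] gives [X]. For [g] itself the switched sum over a subset with a small
    cut is a multiple of 6 of absolute value at most 4, hence 0, and [sum_part_mod4] applies. *)
Lemma tight_of_no_excess6 io F g : wf io F -> connected_halves nu io F ->
  (forall w, (6 %| excess nu F (fun h => sg (g h)) w)%Z) ->
  ~~ (4 %| \sum_(h in F) sg (g h))%Z ->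
  (forall Y, #|boundary nu io F Y| != 2%N) -> ~ excess6 io F g ->
  forall h, h \in F -> exists X, nu h \in X /\ tight nu io F (fun h => sg (g h)) X.
Proof.
move=> wfF connF ex6 odd4 no2 nex h hF.
have evF : even_deg nu F.
  by apply: (@even_deg_excess _ _ nu F g) => w; move: (ex6 w); move: (excess _ _ _ _) => x; lia.
have [gE [cE exE]] := euler_odd wfF connF evF odd4 hF.
have nr : ~ reach nu io F gE (nu h, true) (nu h, false).
  move=> [p [T fp]]; apply: nex.
  have [g' [c' ex']] := trail_flip wfF T erefl fp.
  exists (nu h), g'; split; first exact: compat_trans c' cE.
  by move=> w; rewrite ex' exE; case: eqP.
have [X [s [c [hX cX bound]]]] := reachability_structure wfF connF evF exE nr no2.
have C : compat io F g gE by apply: compat_sym.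
have sub4 Y : Y \subset X -> (c + #|boundary nu io F Y| <= 4)%N ->
    (4 %| \sum_(h in side nu F Y) sg (g h))%Z.
  move=> YX le4; apply: (@sum_part_mod4 _ _ nu _ _ s) => //.
  have := bound g Y C YX.
  have : (6 %| \sum_(h in F | nu h \in Y) sg (g h == s (nu h)))%Z.
    rewrite sum_signed; apply: rpred_sum => w _; exact: dvdz_mull.
  move: le4; move: (\sum_(h in F | _) _) (#|boundary nu io F Y|) => S b; lia.
(* An empty boundary would make [X] carry all half-edges, against the oddness of the total. *)
case: cX => [[bX c2]|[bX c0]].
  have allX : forall k, k \in F -> nu k \in X.
    by apply: bd0_closed connF _ hF hX; apply/eqP; rewrite -cards_eq0 bX.
  have := sub4 X (subxx _); rewrite bX c2 => /(_ isT).
  have -> : \sum_(k in side nu F X) sg (g k) = \sum_(k in F) sg (g k).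
    exact: (dsum_partT (fun k => sg (g k)) allX).
  by rewrite (negPf odd4).
exists X; split=> //; split=> // Y YX b4.
by apply: sub4; rewrite ?c0.
Qed.

Theorem excess6_exists io F g : wf io F -> connected_halves nu io F ->
  (forall w, (6 %| excess nu F (fun h => sg (g h)) w)%Z) ->
  ~~ (4 %| \sum_(h in F) sg (g h))%Z -> excess6 io F g.
Proof.
have [n] := ubnP #|F|; elim: n io F => // n IH io F ltn wfF connF ex6 odd4.
have evF : even_deg nu F.
  by apply: (@even_deg_excess _ _ nu F g) => w; move: (ex6 w); move: (excess _ _ _ _) => x; lia.
have even_sum Y : (2 %| \sum_(h in side nu F Y) sg (g h))%Z.
  rewrite sum_part sum_excess; apply: rpred_sum => w _.
  suff : (2 %| excess nu F (fun h => sg (g h)) w)%Z by [].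
  by move: (ex6 w); move: (excess _ _ _ _) => x; lia.
have [[Y cY]|no2] := pselect (exists Y, #|boundary nu io F Y| == 2%N); last first.
  apply: contrapT => nex.
  have no2' Y : #|boundary nu io F Y| != 2%N by apply/negP => E; apply: no2; exists Y.
  have allT := tight_of_no_excess6 wfF connF ex6 odd4 no2' nex.
  apply: not_all_tight allT => // Y; rewrite -cards_eq0.
  have := no2' Y; have := even_card_bd wfF Y evF.
  by move: #|_| => b; lia.
(* Both sides have even sums and the total is not divisible by 4, so exactly one side has a sum not
   divisible by 4. *)
wlog odd_side : Y cY / ~~ (4 %| \sum_(h in side nu F Y) sg (g h))%Z.
  move=> wl; have [d|] := boolP (4 %| \sum_(h in side nu F Y) sg (g h))%Z; last exact: wl.
  apply: (wl (~: Y)); first by rewrite card_bdC.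
  have := sum_partC nu F Y (fun h => sg (g h)); move: odd4 d.
  move: (\sum_(h in F) _) (\sum_(h in side nu F Y) _) (\sum_(h in side nu F (~: Y)) _).
  by move=> p q r; lia.
have even_side : (4 %| \sum_(h in side nu F (~: Y)) sg (g h))%Z.
  have := sum_partC nu F Y (fun h => sg (g h)); move: odd4 odd_side (even_sum Y) (even_sum (~: Y)).
  move: (\sum_(h in F) _) (\sum_(h in side nu F Y) _) (\sum_(h in side nu F (~: Y)) _).
  by move=> p q r; lia.
case/cards2P: cY => h1 [h2 [h12 bdY]].
have [[F1 Y1 n1] [F2 Y2 n2]] := cut_ends bdY.
apply: (excess6_lift _ _ _ bdY h12 even_side) => //.
apply: IH => //.
- rewrite -ltnS; apply: leq_trans ltn; rewrite ltnS; apply: proper_card.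
  apply/properP; split; first by apply/subsetP => h; rewrite inE => /andP[].
  by exists (io h1); rewrite ?(io_in wfF) // inE (negPf n1) andbF.
- exact: (wf_twist wfF bdY h12).
- exact: (conn_twist wfF bdY h12).
move=> w; have [wY|wY] := boolP (w \in Y); first by rewrite excess_part.
by rewrite excess_part0.
Qed.

End Core.

(** * Odd closed trails *)

Section Decomposition.
Variables (H V : finType) (nu : H -> V) (io : H -> H).
Implicit Types (F S A B O : {set H}) (g : H -> bool) (Y : {set V}) (p : seq H).

Lemma conn_setU A B a b : connected_halves nu io A -> connected_halves nu io B -> a \in A -> b \in B ->
  nu a = nu b -> connected_halves nu io (A :|: B).
Proof.
move=> cA cB aA bB ab Y cl ne.
have clA h : h \in A -> nu h \in Y -> nu (io h) \in Y.
  by move=> hA; apply: cl; rewrite inE hA.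
have clB h : h \in B -> nu h \in Y -> nu (io h) \in Y.
  by move=> hB; apply: cl; rewrite inE hB orbT.
suff aY : nu a \in Y.
  move=> h; rewrite inE => /orP[hA|hB].
    by apply: (cA Y clA) => //; exists a.
  by apply: (cB Y clB) => //; exists b; rewrite -?ab.
case: ne => k; rewrite inE => /orP[kA|kB] kY.
  by apply: (cA Y clA) => //; exists k.
by rewrite ab; apply: (cB Y clB) => //; exists k.
Qed.

Lemma wf_sub F S : wf io F -> S \subset F -> (forall h, h \in S -> io h \in S) -> wf io S.
Proof.
move=> wfF SF cl h hS; have [_ n1 k1] := wfF h (subsetP SF _ hS).
by split=> //; apply: cl.
Qed.

Lemma wf_setD F S : wf io F -> wf io S -> S \subset F -> wf io (F :\: S).
Proof.
move=> wfF wfS SF; apply: (wf_sub wfF); first exact: subsetDl.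
move=> h; rewrite !inE => /andP[hS hF]; rewrite (io_in wfF) // andbT.
by apply: contra hS => /(io_in wfS); rewrite (ioK wfF).
Qed.

Lemma wf_setU F S : wf io F -> wf io S -> wf io (F :|: S).
Proof.
by move=> wF wS h; rewrite inE => /orP[/wF|/wS] [i1 i2 i3]; rewrite inE i1 ?orbT.
Qed.

Lemma excess_setD F A (f : H -> int) w : A \subset F -> excess nu (F :\: A) f w = excess nu F f w - excess nu A f w.
Proof.
move=> AF; rewrite -{2}(setID F A) (setIidPr AF) excessU ?[excess nu A f w + _]addrC ?addrK //.
rewrite -setI_eq0; apply/eqP/setP => h.
by rewrite !inE; case: (h \in A).
Qed.

Section InSet.
Variables (S : {set H}) (g : H -> bool).
Hypothesis wfS : wf io S.

Lemma wf_eset_of p : {subset p <= S} -> wf io (eset_of io p).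
Proof.
move=> sp; apply: (wf_sub wfS); first exact: eset_of_sub.
move=> h; rewrite !inE => hp; rewrite (edges_io wfS sp) //.
exact: (edges_sub wfS sp).
Qed.

Lemma conn_walk x p : walk (sdep nu g) (snx nu io g) S x p ->
  connected_halves nu io (eset_of io p).
Proof.
move=> wp Y cl ne; have sp := walk_sub wp.
have {}cl h : h \in p -> (nu h \in Y) = (nu (io h) \in Y).
  move=> hp; have hF := sp h hp.
  have hE : h \in eset_of io p by rewrite inE mem_cat hp.
  have ihE : io h \in eset_of io p by rewrite inE (edges_io wfS sp) // mem_cat hp.
  apply/idP/idP; first exact: cl.
  by move/(cl _ ihE); rewrite (ioK wfS).
have key : forall h, h \in p -> (nu h \in Y) = (x.1 \in Y).
  elim: p x wp {sp ne} cl => //= h p IH x /and3P[hF /eqP<- wp] cl k.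
  rewrite inE => /orP[/eqP->//|kp].
  rewrite (IH _ wp) //= ?(cl h) ?inE ?eqxx // => j jp.
  by apply: cl; rewrite inE jp orbT.
have keyE h : h \in eset_of io p -> (nu h \in Y) = (x.1 \in Y).
  rewrite inE => hE; have hF := edges_sub wfS sp hE.
  move: hE; rewrite (mem_edges wfS sp hF) => /orP[hp|hp]; first exact: key.
  by rewrite -(key _ hp) (cl _ hp) (ioK wfS).
by case: ne => k kE; rewrite (keyE _ kE) => xY h hE; rewrite keyE.
Qed.

Lemma exists_stuck_trail x p0 : trail nu io S g x p0 ->
  exists p, [/\ trail nu io S g x p, (size p0 <= size p)%N &
    forall h, h \in S -> sdep nu g h = endpoint (snx nu io g) x p -> h \in edges io p].
Proof.
move=> T0; have bnd p : trail nu io S g x p -> (size p <= #|H|)%N.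
  by move=> /andP[_]; apply: simple_size.
have [p [T pmax]] := exists_longest T0 bnd.
exists p; split=> //; first exact: pmax.
move=> h hS dh; apply: contraT => hp.
by have := pmax _ (trail_rcons wfS T hS dh hp); rewrite size_rcons ltnn.
Qed.

Lemma excess_trail x p w : trail nu io S g x p ->
  excess nu (eset_of io p) (fun h => sg (g h)) w =
  (if (endpoint (snx nu io g) x p).1 == w then sg (endpoint (snx nu io g) x p).2 else 0) -
  (if x.1 == w then sg x.2 else 0).
Proof.
by case/andP=> wp sp; rewrite /excess sum_edges // (sum_swalk w wp).
Qed.

Lemma stuck_excess x p y : trail nu io S g x p -> endpoint (snx nu io g) x p = y ->
  (forall h, h \in S -> sdep nu g h = endpoint (snx nu io g) x p -> h \in edges io p) ->
  0 <= sg y.2 * (excess nu S (fun h => sg (g h)) y.1 -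
                 excess nu (eset_of io p) (fun h => sg (g h)) y.1).
Proof.
move=> T fy stuck; have sub := eset_of_sub wfS (trail_sub T).
rewrite -excess_setD //.
rewrite /excess mulr_sumr; apply: sumr_ge0 => h /andP[]; rewrite inE => /andP[hp hS] /eqP hy.
have gy : g h = y.2.
  apply/eqP; apply: contraT => ne; case/negP: hp; rewrite inE; apply: stuck => //.
  rewrite fy /sdep hy; case: (y) ne => w b /=; case: (g h); by case: b.
by rewrite gy; case: (y.2).
Qed.

Lemma exists_odd_part v : (forall w, w != v -> excess nu S (fun h => sg (g h)) w = 0) ->
  0 < excess nu S (fun h => sg (g h)) v ->
  exists O, [/\ O \subset S, wf io O, connected_halves nu io O, (exists2 h, h \in O & nu h = v) &
    forall w, excess nu O (fun h => sg (g h)) w = if w == v then 2 else 0].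
Proof.
move=> ex0 exv.
have T0 : trail nu io S g (v, false) [::] by [].
have [p [T _ stuck]] := exists_stuck_trail T0.
have exT w := excess_trail w T.
have fp : endpoint (snx nu io g) (v, false) p = (v, true).
  have := stuck_excess T erefl stuck; move: exT.
  case: (endpoint _ _ _) => w b /= exT; rewrite exT eqxx /= [v == w]eq_sym.
  have [->|ne] := eqVneq w v; last first.
    by rewrite ex0 //; case: (b).
  by case: (b) => //; move: exv; move: (excess _ _ _ _) => e; rewrite /sg; lia.
have exO w : excess nu (eset_of io p) (fun h => sg (g h)) w = if w == v then 2 else 0.
  by rewrite exT fp /= eq_sym; case: eqP.
exists (eset_of io p); split=> //.
- exact (eset_of_sub wfS (trail_sub T)).
- exact: wf_eset_of (trail_sub T).
- by case/andP: T => /conn_walk.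
have [h /andP[hE /eqP hv]|none] := pickP (fun h => (h \in eset_of io p) && (nu h == v)).
  by exists h.
have := exO v; rewrite eqxx /excess big_pred0 //.
Qed.

(** With all excesses 0, a nonempty maximal trail is stuck only on returning to its initial
    state. *)
Lemma exists_even_part r : (forall w, excess nu S (fun h => sg (g h)) w = 0) -> r \in S ->
  exists O, [/\ O \subset S, wf io O, connected_halves nu io O, (exists2 h, h \in O & nu h = nu r) &
    forall w, excess nu O (fun h => sg (g h)) w = 0].
Proof.
move=> ex0 rS.
have T0 : trail nu io S g (sdep nu g r) [:: r].
  by rewrite /trail /= rS eqxx (simple1 wfS).
have [p [T szp stuck]] := exists_stuck_trail T0.
have exT w := excess_trail w T.
have fp : endpoint (snx nu io g) (sdep nu g r) p = sdep nu g r.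
  have := stuck_excess T erefl stuck; rewrite ex0 exT eqxx.
  case: (endpoint _ _ _) => w b /=; case: eqP => [<-|_]; last by case: (b).
  by rewrite /sdep; case: (b); case: (g r).
exists (eset_of io p); split=> //.
- exact (eset_of_sub wfS (trail_sub T)).
- exact: wf_eset_of (trail_sub T).
- by case/andP: T => /conn_walk.
- case: p szp T {stuck exT fp} => // k p _ /andP[/= /and3P[_ /eqP[dk _] _] _].
  by exists k; rewrite ?inE ?mem_cat ?inE ?eqxx.
by move=> w; rewrite exT fp subrr.
Qed.

End InSet.

Section Three.
Variables (F : {set H}) (g : H -> bool) (v : V).
Hypotheses (wfF : wf io F) (connF : connected_halves nu io F).
Hypothesis ex6 : forall w, excess nu F (fun h => sg (g h)) w = if w == v then 6 else 0.

Definition odd_part (S : {set H}) : Prop := [/\ S \subset F, wf io S, connected_halves nu io S,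
  exists2 h, h \in S & nu h = v &
  forall w, excess nu S (fun h => sg (g h)) w = if w == v then 2 else 0].

Definition three_odd (S : 'I_3 -> {set H}) : Prop :=
  (forall i, odd_part (S i)) /\ forall i j, i != j -> [disjoint S i & S j].

(** Applied with [c] equal to 6, 4 and 2 to obtain the three parts. *)
Lemma peel (S : {set H}) (c : int) : S \subset F -> wf io S ->
  (forall w, excess nu S (fun h => sg (g h)) w = if w == v then c else 0) -> 0 < c ->
  exists O, [/\ O \subset S, odd_part O, wf io (S :\: O) &
    forall w, excess nu (S :\: O) (fun h => sg (g h)) w = if w == v then c - 2 else 0].
Proof.
move=> SF wfS exS c0.
have [||O [OS wfO cO tO exO]] := @exists_odd_part S g wfS v.
- by move=> w /negPf wv; rewrite exS wv.
- by rewrite exS eqxx.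
exists O; split=> //.
- by split=> //; apply: subset_trans SF.
- exact: wf_setD.
by move=> w; rewrite excess_setD // exS exO; case: eqP => //; rewrite subrr.
Qed.

Lemma disjoint_setD (A B C : {set H}) : C \subset B :\: A -> [disjoint A & C].
Proof.
move=> sub; rewrite disjoint_sym -setI_eq0; apply/eqP/setP => h; rewrite !inE.
by apply/andP => -[/(subsetP sub)]; rewrite inE => /andP[/negPf->].
Qed.

Lemma three_odd_init : exists S : 'I_3 -> {set H}, three_odd S.
Proof.
have [O1 [s1 o1 w1 e1]] := peel (subxx F) wfF ex6 isT.
have F1 : F :\: O1 \subset F by apply: subsetDl.
have [O2 [s2 o2 w2 e2]] := peel F1 w1 e1 isT.
have F2 : F :\: O1 :\: O2 \subset F by apply: subset_trans F1; apply: subsetDl.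
have [O3 [s3 o3 _ _]] := peel F2 w2 e2 isT.
have d12 := disjoint_setD s2; have d23 := disjoint_setD s3.
have d13 : [disjoint O1 & O3].
  by apply: (@disjoint_setD _ F); apply: subset_trans s3 (subsetDl _ _).
exists (fun i => nth F [:: O1; O2; O3] i); split.
  by case=> [[|[|[|n]]] ltn].
by case=> [[|[|[|n]]] ltn] [[|[|[|m]]] ltm] //= _; rewrite // disjoint_sym.
Qed.

Lemma excess_three (S : 'I_3 -> {set H}) f w : (forall i j, i != j -> [disjoint S i & S j]) ->
  excess nu (\bigcup_i S i) f w = \sum_i excess nu (S i) f w.
Proof.
move=> dis; rewrite !big_ord_recl !big_ord0 setU0 addr0.
rewrite !excessU ?dis //; have := dis ord0 (lift ord0 ord0) isT.
have := dis ord0 (lift ord0 (lift ord0 ord0)) isT.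
by rewrite -!setI_eq0 setIUr => /eqP-> /eqP->; rewrite setU0.
Qed.

(** What three odd parts leave over has excess 0. By connectivity some leftover half-edge lies at a
    vertex of a part, and a closed trail through that vertex is absorbed by the part. *)
Theorem three_odd_parts : exists S : 'I_3 -> {set H}, three_odd S /\ \bigcup_i S i = F.
Proof.
have [S0 T0] := three_odd_init; have [n] := ubnP #|F :\: \bigcup_i S0 i|.
elim: n S0 T0 => // n IH S [oS dis] ltn.
set U := \bigcup_i S i in ltn.
have UF : U \subset F by apply/bigcupsP => i _; case: (oS i).
have wfU : wf io U.
  apply: (wf_sub wfF UF) => h /bigcupP[i _ hS]; apply/bigcupP; exists i => //.
  by have [_ wfS _ _ _] := oS i; apply: (io_in wfS).
have exR w : excess nu (F :\: U) (fun h => sg (g h)) w = 0.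
  rewrite excess_setD // excess_three // ex6 (eq_bigr (fun=> if w == v then 2 else 0)).
    by rewrite sumr_const card_ord; case: eqP.
  by move=> i _; have [_ _ _ _ ->] := oS i.
have [R0|[r0 r0R]] := set_0Vmem (F :\: U).
  exists S; split=> //; apply/eqP; rewrite eqEsubset UF /= -setD_eq0 -/U R0 //.
have [r [i [k [rR kS kr]]]] : exists r i k, [/\ r \in F :\: U, k \in S i & nu k = nu r].
  apply: contrapT => none.
  pose Y := [set w | [exists k in U, nu k == w]].
  have inU h : h \in F -> nu h \in Y -> h \in U.
    move=> hF; rewrite inE => /existsP[k /andP[/bigcupP[i _ kS] /eqP kh]].
    by apply: contraT => hU; case: none; exists h, i, k; rewrite inE hU hF.
  have : nu r0 \in Y.
    move: r0R; rewrite inE => /andP[_ r0F].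
    apply: (connF (Y := Y)) => //.
      move=> h hF hY; rewrite inE; apply/existsP; exists (io h); rewrite eqxx andbT.
      exact: (io_in wfU (inU h hF hY)).
    have [_ _ _ [h hS hv] _] := oS ord0.
    have hU : h \in U by apply/bigcupP; exists ord0.
    exists h; first exact: (subsetP UF).
    by rewrite inE; apply/existsP; exists h; rewrite hU eqxx.
  by move: r0R; rewrite inE => /andP[r0U r0F] /(inU _ r0F); apply/negP.
have wfR := wf_setD wfF wfU UF.
have [O [OR wfO cO [o oO onu] exO]] := exists_even_part wfR exR rR.
have disO j : [disjoint S j & O].
  have sub : S j \subset U by apply: (bigcup_sup j).
  exact: disjointWl sub (disjoint_setD OR).
pose S' j := if j == i then S i :|: O else S j.
have subS j : S j \subset S' j.
  by rewrite /S'; case: eqP => [->|_]; rewrite ?subsetUl.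
apply: (IH S').
- split.
    move=> j; rewrite /S'; case: eqP => // _; have [sF wfS cS [h hS hv] eS] := oS i.
    split.
    + by rewrite subUset sF; apply: subset_trans OR (subsetDl _ _).
    + exact: wf_setU.
    + by apply: conn_setU cS cO kS oO _; rewrite kr onu.
    + by exists h; rewrite // inE hS.
    by move=> w; rewrite excessU // eS exO addr0.
  move=> j l ne; rewrite /S'; case: eqP => [ji|_]; case: eqP => [li|_]; last exact: dis.
  + by move: ne; rewrite ji li eqxx.
  + rewrite disjoint_sym -setI_eq0 setIUr setU_eq0 !setI_eq0 disO andbT.
    by apply: dis; rewrite eq_sym -ji.
  rewrite -setI_eq0 setIUr setU_eq0 !setI_eq0 disO andbT.
  by apply: dis; rewrite -li.
rewrite -ltnS; apply: leq_trans ltn; rewrite ltnS; apply: proper_card.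
have oR := subsetP OR _ oO.
apply/properP; split.
  by apply: setDS; apply/bigcupsP => j _; apply: subset_trans (subS j) (bigcup_sup j _).
exists o => //; rewrite inE negb_and negbK; apply/orP; left.
by apply/bigcupP; exists i => //; rewrite /S' eqxx inE oO orbT.
Qed.

End Three.
End Decomposition.

(** * Balance and potentials *)

Section Potentials.
Variable G : sgraph.
Implicit Types (e f : edge G) (u v w x y : vertex G) (C P F : {set edge G}).
Implicit Types (h k : edge G * bool) (s : vertex G -> bool).

Definition twin (h : edge G * bool) : edge G * bool := (h.1, ~~ h.2).
Definition halfedges C : {set edge G * bool} := [set h | h.1 \in C].

Lemma wf_halfedges C : wf twin (halfedges C).
Proof.
move=> h; rewrite !inE => hC; rewrite hC /twin /= negbK -surjective_pairing; split=> //.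
by rewrite [h in _ != h]surjective_pairing xpair_eqE eqxx; case: h.2.
Qed.

Lemma sum_halfedges C (p : edge G * bool -> int) :
  \sum_(h in halfedges C) p h = \sum_(e in C) (p (e, true) + p (e, false)).
Proof.
rewrite big_mkcond [RHS]big_mkcond /=.
transitivity (\sum_e \sum_b if e \in C then p (e, b) else 0).
  by rewrite pair_big /=; apply: eq_bigr => -[e b] _; rewrite inE.
by apply: eq_bigr => e _; rewrite big_bool; case: ifP; rewrite ?addr0.
Qed.

(** Incidence modulo 2: a loop vanishes. *)
Definition incident e w : bool := (endv (e, true) == w) (+) (endv (e, false) == w).
Definition oddness C w : bool := \big[addb/false]_(e in C) incident e w.
Definition odd_neg C : bool := \big[addb/false]_(e in C) negative e.
(** The edge becomes positive when the vertices in [s] are switched. *)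
Definition positive_on s e : bool := negative e == s (endv (e, true)) (+) s (endv (e, false)).

Lemma odd_sum (I : Type) (r : seq I) (p : pred I) (n : I -> nat) :
  odd (\sum_(i <- r | p i) n i) = \big[addb/false]_(i <- r | p i) odd (n i).
Proof. exact: (big_morph odd oddD). Qed.

Lemma odd_card_neg C : odd #|[set e in C | negative e]| = odd_neg C.
Proof.
rewrite -sum1_card odd_sum /odd_neg [LHS]big_mkcond [RHS]big_mkcond.
by apply: eq_bigr => e _; rewrite inE; case: (e \in C) => //; case: negative.
Qed.

Lemma oddnessE C w : odd #|halves (@endv G) (halfedges C) w| = oddness C w.
Proof.
have E : #|halves (@endv G) (halfedges C) w|%:Z =
    \sum_(e in C) ((endv (e, true) == w)%:Z + (endv (e, false) == w)%:Z).
  rewrite card_halves -(sum_halfedges C (fun h => (endv h == w)%:Z)) big_mkcondr.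
  by apply: eq_bigr => h _; case: eqP.
have -> : #|halves (@endv G) (halfedges C) w| =
    (\sum_(e in C) ((endv (e, true) == w) + (endv (e, false) == w)))%N.
  apply/eqP; rewrite -eqz_nat E; apply/eqP.
  by rewrite -[RHS]natz natr_sum; apply: eq_bigr => e _; rewrite natz PoszD.
rewrite odd_sum; apply: eq_bigr => e _.
by rewrite /incident; case: eqP; case: eqP.
Qed.

Lemma xor_select s x : s x = \big[addb/false]_w (s w && (x == w)).
Proof.
rewrite (bigD1 x) //= eqxx andbT big1 ?addbF // => w /negPf wx.
by rewrite eq_sym wx andbF.
Qed.

(* Each vertex contributes its potential once per incident half-edge. *)
Lemma odd_neg_potential s C : (forall e, e \in C -> positive_on s e) ->
  odd_neg C = \big[addb/false]_w (s w && oddness C w).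
Proof.
move=> sC; transitivity (\big[addb/false]_(e in C) \big[addb/false]_w (s w && incident e w)).
  apply: eq_bigr => e eC; rewrite (eqP (sC e eC)) (xor_select s (endv (e, true))).
  rewrite (xor_select s (endv (e, false))) -big_split; apply: eq_bigr => w _ /=.
  by rewrite /incident; case: (s w).
rewrite exchange_big; apply: eq_bigr => w _; rewrite /oddness.
case: (s w) => /=; first exact: eq_bigr.
by rewrite big1.
Qed.

Lemma toggle P f : exists P', P' \subset f |: P /\
  forall w, oddness P' w = oddness P w (+) incident f w.
Proof.
have [fP|fP] := boolP (f \in P).
  exists (P :\ f); split; first by apply: subset_trans (subD1set _ _) (subsetUr _ _).
  move=> w; rewrite {2}/oddness (big_setD1 f fP) /= -/(oddness (P :\ f) w).
  by case: (oddness _ _); case: (incident _ _).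
exists (f |: P); split=> // w; rewrite /oddness big_setU1 //=.
exact: addbC.
Qed.

(* Edges are added one at a time: if the new edge [e] violates the potential, either
   a path joining its ends closes an odd cycle, or the potential is flipped on the
   part reachable from one end. *)
Lemma potential_or_odd F : (exists s, forall e, e \in F -> positive_on s e) \/
  exists C, [/\ C \subset F, forall w, ~~ oddness C w & odd_neg C].
Proof.
have [n] := ubnP #|F|; elim: n F => // n IH F ltn.
have [->|[e eF]] := set_0Vmem F.
  by left; exists (fun=> false) => e; rewrite inE.
have ltF : (#|F :\ e| < n)%N by move: ltn; rewrite (cardsD1 e F) eF; lia.
have [[s sF]|[C [CF oC nC]]] := IH _ ltF; last first.
  by right; exists C; split=> //; apply: subset_trans CF (subD1set _ _).
have [se|se] := boolP (positive_on s e).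
  left; exists s => f fF; have [->//|fe] := eqVneq f e.
  by apply: sF; rewrite !inE fe.
set x := endv (e, true); set y := endv (e, false).
(* A path from [x] to [w] is kept modulo 2, as an edge set with odd valency just at its two ends. *)
pose link w := exists P, P \subset F :\ e /\ forall u, oddness P u = (x == u) (+) (w == u).
have [[P [PF oP]]|nl] := pselect (link y).
  right; exists (e |: P).
  have eP : e \notin P by apply: contraTN eF => /(subsetP PF); rewrite !inE eqxx.
  split.
  - by rewrite subUset sub1set eF; apply: subset_trans PF (subD1set _ _).
  - move=> w; rewrite /oddness big_setU1 //= -/(oddness P w) oP /incident.
    by rewrite -/x -/y; case: (x == w); case: (y == w).
  rewrite /odd_neg big_setU1 //= -/(odd_neg P) (odd_neg_potential (s := s)).
    rewrite (eq_bigr (fun w => (s w && (x == w)) (+) (s w && (y == w)))); last first.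
      by move=> w _; rewrite oP; case: (s w).
    rewrite big_split /= -!xor_select; move: se; rewrite /positive_on -/x -/y.
    by case: (negative e); case: (s x); case: (s y).
  by move=> f /(subsetP PF); apply: sF.
left; pose Y w := `[< link w >].
have Ystep f b : f \in F :\ e -> Y (endv (f, b)) -> Y (endv (f, ~~ b)).
  move=> fF /asboolP[P [PF oP]]; have [P' [P'P oP']] := toggle P f.
  apply/asboolP; exists P'; split.
    by apply: subset_trans P'P _; rewrite subUset sub1set fF.
  move=> u; rewrite oP' oP /incident.
  by case: (b) => /=; do 3!case: (_ == u).
have Yinv f : f \in F :\ e -> Y (endv (f, true)) = Y (endv (f, false)).
  by move=> fF; apply/idP/idP; [apply: (Ystep f true) | apply: (Ystep f false)].
exists (fun w => s w (+) Y w) => f fF; have [->|fe] := eqVneq f e.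
  have Yx : Y x.
    apply/asboolP; exists set0; split; first exact: sub0set.
    by move=> u; rewrite /oddness big_set0 addbb.
  have Yy : Y y = false by apply/asboolP.
  move: se; rewrite /positive_on -/x -/y Yx Yy.
  by case: (negative e); case: (s x); case: (s y).
have fF' : f \in F :\ e by rewrite !inE fe.
have := sF f fF'; rewrite /positive_on (Yinv f fF').
by case: (negative f); case: (s _); case: (s _); case: (Y _).
Qed.

Definition touched C : {set vertex G} := [set w | [exists h in halfedges C, endv h == w]].

Lemma touchedP C w : reflect (exists2 h, h \in halfedges C & endv h = w) (w \in touched C).
Proof.
rewrite inE; apply: (iffP existsP) => [[h /andP[hC /eqP hw]]|[h hC hw]].
  by exists h.
by exists h; rewrite hC hw eqxx.
Qed.

Lemma endv_touched C e (b : bool) : e \in C -> endv (e, b) \in touched C.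
Proof. by move=> eC; apply/touchedP; exists (e, b); rewrite ?inE. Qed.

Definition edge_subgraph C : subgraph G := @Subgraph G (touched C) C (@endv_touched C).

Lemma valencyE (K : subgraph G) w :
  valency K w = #|halves (@endv G) (halfedges (eset K)) w|.
Proof. by apply: eq_card => h; rewrite !inE. Qed.

Lemma signE (K : subgraph G) : sign K = if odd_neg (eset K) then -1 else 1.
Proof.
rewrite /sign /sigma prodrXr -signr_odd odd_sum /odd_neg.
by under eq_bigr do rewrite oddb; case: (\big[_/_]_(_ in _) _).
Qed.

Section MinimalEven.
Variable C : {set edge G}.
Hypotheses (evC : forall w, ~~ oddness C w).
Hypothesis minC : forall P, P \subset C -> P != set0 -> (forall w, ~~ oddness P w) -> P = C.

(** A set is grown from one edge at [w], with odd valency just at [w] and at its moving end [u],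
    where the even set [C] offers a further edge. On the return to [w] the set is even, hence all of
    [C], and it has used two half-edges at [w]. *)
Lemma minimal_even_valency w : w \in touched C -> #|halves (@endv G) (halfedges C) w| = 2%N.
Proof.
case/touchedP=> h0; rewrite inE => hC hw.
have grow P u : P \subset C -> u != w -> (forall x, oddness P x = (w == x) (+) (u == x)) ->
    #|halves (@endv G) (halfedges P) w| = 1%N -> #|halves (@endv G) (halfedges C) w| = 2%N.
  have [n] := ubnP #|C :\: P|; elim: n P u => // n IH P u ltn PC uw oP P1.
  have [k [kC kP ku]] : exists k, [/\ k.1 \in C, k.1 \notin P & endv k = u].
    apply: contrapT => none.
    have E : halves (@endv G) (halfedges C) u = halves (@endv G) (halfedges P) u.
      apply/setP => k; rewrite !inE; case: eqP => [ku|_]; rewrite ?andbF ?andbT //.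
      apply/idP/idP => [kC|/(subsetP PC)//]; apply: contraT => kP.
      by case: none; exists k.
    have := evC u; rewrite -oddnessE E oddnessE oP eqxx eq_sym (negPf uw) //.
  set z := endv (twin k).
  have oP' x : oddness (k.1 |: P) x = (w == x) (+) (z == x).
    rewrite /oddness big_setU1 //= -/(oddness P x) oP -ku /z /twin /incident.
    case: (k) => f b /=; rewrite /= ; case: b => /=;
    by case: (_ == x); case: (_ == x); case: (_ == x).
  have P'C : k.1 |: P \subset C by rewrite subUset sub1set kC.
  have cardP' : #|halves (@endv G) (halfedges (k.1 |: P)) w| = (1 + (z == w))%N.
    have -> : halves (@endv G) (halfedges (k.1 |: P)) w =
        halves (@endv G) (halfedges P) w :|: (if z == w then [set twin k] else set0).
      apply/setP => j; rewrite !inE; case: (eqVneq j.1 k.1) => [jk|jk] /=.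
        rewrite jk (negPf kP) /=.
        have [->|->] : j = k \/ j = twin k.
          case: (j) jk => f b; rewrite /twin (surjective_pairing k) /= => ->.
          by case: b; case: k.2; auto.
          rewrite ku (negPf uw); case: ifP; rewrite ?inE //.
          by case: (k) => f []; rewrite /twin /= xpair_eqE eqxx.
        by rewrite -/z; case: ifP; rewrite !inE ?eqxx.
      case: ifP => _; rewrite ?inE ?orbF //.
      have -> : (j == twin k) = false by apply: contraNF jk => /eqP->.
      by rewrite orbF.
    rewrite cardsU P1; case: ifP => zw; last by rewrite cards0 setI0 cards0.
    rewrite cards1; have -> : halves (@endv G) (halfedges P) w :&: [set twin k] = set0;
      last by rewrite cards0.
      apply/setP => j; rewrite !inE; apply/negP => /andP[/andP[jP _] /eqP E].
      by move: jP; rewrite E /= (negPf kP).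
  have [zw|zw] := eqVneq z w.
    rewrite -(minC P'C) ?cardP' ?zw ?eqxx //.
      by apply/set0Pn; exists k.1; rewrite setU11.
    by move=> x; rewrite oP' zw addbb.
  apply: (IH (k.1 |: P) z) => //; last by rewrite cardP' (negPf zw).
  rewrite -ltnS; apply: leq_trans ltn; rewrite ltnS; apply: proper_card.
  apply/properP; split; first by apply: setDS; apply: subsetUr.
  by exists k.1; rewrite !inE ?eqxx ?kC ?kP.
have inc x : oddness [set h0.1] x = (w == x) (+) (endv (twin h0) == x).
  rewrite /oddness big_set1 /incident -hw /twin; case: (h0) => f [] //=.
  exact: addbC.
have sub1 : [set h0.1] \subset C by rewrite sub1set.
have [lw|lw] := eqVneq (endv (twin h0)) w.
  rewrite -(minC sub1); last 2 first.
  - by apply/set0Pn; exists h0.1; rewrite inE.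
  - by move=> x; rewrite inc lw addbb.
  have -> : halves (@endv G) (halfedges [set h0.1]) w = [set h0; twin h0].
    apply/setP => j; rewrite !inE; apply/andP/orP => [[/eqP jh _]|[]/eqP->]; last 2 first.
    - by rewrite hw !eqxx.
    - by rewrite lw !eqxx.
    case: (j) jh => f b; rewrite /twin (surjective_pairing h0) /= => ->.
    by rewrite !xpair_eqE eqxx /=; case: b; case: h0.2; auto.
  rewrite cards2; case: (h0) => f b; rewrite /twin /= xpair_eqE eqxx /=.
  by case: b.
apply: (grow [set h0.1] (endv (twin h0))) => //.
have -> : halves (@endv G) (halfedges [set h0.1]) w = [set h0]; last by rewrite cards1.
apply/setP => j; rewrite !inE; apply/andP/eqP => [[/eqP jh /eqP jw]|->]; last first.
  by rewrite hw !eqxx.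
have [//|E] : j = h0 \/ j = twin h0.
  case: (j) jh => f b; rewrite /twin (surjective_pairing h0) /= => ->.
  by case: b; case: h0.2; auto.
by case/eqP: lw; rewrite -E.
Qed.

(** The edges of a component form a nonempty even subset. *)
Lemma minimal_even_connected : C != set0 -> connected (edge_subgraph C).
Proof.
case/set0Pn=> e0 e0C; split.
  by apply/set0Pn; exists (endv (e0, true)); apply: endv_touched.
move=> x y xs ys; pose K := edge_subgraph C.
have adj e b : e \in C -> connect (adjacent K) (endv (e, b)) (endv (e, ~~ b)).
  move=> eC; apply: connect1; apply/existsP; exists e; rewrite /= eC.
  by apply/existsP; exists b; rewrite !eqxx.
pose P := [set e in C | connect (adjacent K) x (endv (e, true))].
have inP e b : e \in C -> (e \in P) = connect (adjacent K) x (endv (e, b)).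
  move=> eC; rewrite inE eC /=; case: b => //.
  by apply/idP/idP => c; [apply: connect_trans c (adj e true eC)
     | apply: connect_trans c (adj e false eC)].
have PC : P \subset C by apply/subsetP => e; rewrite inE => /andP[].
have evP w : ~~ oddness P w.
  rewrite -oddnessE; have [c|c] := boolP (connect (adjacent K) x w).
    have -> : halves (@endv G) (halfedges P) w = halves (@endv G) (halfedges C) w.
      apply/setP => -[e b]; rewrite !in_set /=; case: eqP => [ew|_]; rewrite ?andbF //.
      rewrite !andbT; case eC: (e \in C) => //=.
      by have := inP e b eC; rewrite inE eC ew c.
    by rewrite oddnessE.
  have -> : halves (@endv G) (halfedges P) w = set0; last by rewrite cards0.
  apply/setP => -[e b]; rewrite !in_set /=; case: eqP => [ew|_]; rewrite ?andbF //.
  rewrite andbT; case eC: (e \in C) => //=.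
  by have := inP e b eC; rewrite inE eC ew (negPf c).
have neP : P != set0.
  case/touchedP: xs => -[e b]; rewrite inE /= => eC ex1.
  by apply/set0Pn; exists e; rewrite (inP e b eC) ex1 connect0.
have EP := minC PC neP evP.
case/touchedP: ys => -[e b]; rewrite inE /= => eC <-.
by rewrite -(inP e b eC) EP.
Qed.

End MinimalEven.

(** Splitting off a proper even subset leaves one of two smaller even sets with an odd number of
    negative edges; a set that cannot be split is a circuit. *)
Lemma exists_unbalanced_circuit C : (forall w, ~~ oddness C w) -> odd_neg C ->
  exists K : subgraph G, eset K \subset C /\ unbalanced_circuit K.
Proof.
have [n] := ubnP #|C|; elim: n C => // n IH C ltn evC nC.
have [[P [PC [neP [neC evP]]]]|none] := pselect (exists P, P \subset C /\
    P != set0 /\ P != C /\ forall w, ~~ oddness P w).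
  have split_big (p : edge G -> bool) : \big[addb/false]_(e in C) p e =
      (\big[addb/false]_(e in P) p e) (+) \big[addb/false]_(e in C :\: P) p e.
    by rewrite (big_setID P) /= (setIidPr PC).
  have ltP : (#|P| < #|C|)%N by apply: proper_card; rewrite properEneq neC.
  have ltD : (#|C :\: P| < #|C|)%N.
    rewrite -(cardsID P C) (setIidPr PC) -[X in (X < _)%N]add0n ltn_add2r.
    by rewrite card_gt0.
  case nP: (odd_neg P).
    have [|K [KP uK]] := IH P _ evP nP; first exact: leq_trans ltP ltn.
    by exists K; split=> //; apply: subset_trans PC.
  have [|||K [KP uK]] := IH (C :\: P).
  - exact: leq_trans ltD ltn.
  - move=> w; have := evC w; rewrite /oddness split_big -/(oddness P w).
    by rewrite (negPf (evP w)).
  - by move: nC; rewrite /odd_neg split_big -/(odd_neg P) nP.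
  by exists K; split=> //; apply: subset_trans KP (subsetDl _ _).
have minC P : P \subset C -> P != set0 -> (forall w, ~~ oddness P w) -> P = C.
  move=> PC neP evP; apply/eqP; apply: contraT => neC.
  by case: none; exists P.
exists (edge_subgraph C); split=> //; split; last by rewrite signE /= nC.
split; last by move=> w wC; rewrite valencyE; apply: minimal_even_valency.
apply: minimal_even_connected => //; apply: contraTneq nC => ->.
by rewrite /odd_neg big_set0.
Qed.

Lemma potential_balanced s (K : subgraph G) :
  (forall e, e \in eset K -> positive_on s e) -> balanced K.
Proof.
move=> sK [C [[_ CK] [[_ val2] signC]]].
have n0 : odd_neg (eset C) = false.
  rewrite (odd_neg_potential (s := s)) => [|e /(subsetP CK)/sK//].
  rewrite big1 // => w _; rewrite -oddnessE -valencyE.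
  have [/val2->|wC] := boolP (w \in vset C); rewrite ?andbF //.
  rewrite (_ : valency C w = 0%N) ?andbF //; apply: eq_card0 => -[e b].
  rewrite !inE /=; apply/andP => -[eC /eqP ew].
  by case/negP: wC; rewrite -ew; apply: endv_vset.
by move: signC; rewrite signE n0.
Qed.

Lemma balanced_potential (K : subgraph G) : vset K = [set: vertex G] -> balanced K ->
  exists s, forall e, e \in eset K -> positive_on s e.
Proof.
move=> vK bK; have [//|[C [CK evC nC]]] := potential_or_odd (eset K).
have [Q [QC uQ]] := exists_unbalanced_circuit evC nC; case: bK; exists Q; split=> //.
by split; [rewrite vK subsetT | apply: subset_trans QC CK].
Qed.

End Potentials.

(** * Flows on signed eulerian graphs *)

Section Flows.
Variable G : sgraph.
Implicit Types (e : edge G) (v w : vertex G) (C : {set edge G}) (K : subgraph G).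
Implicit Types (h : edge G * bool) (o g : edge G * bool -> bool).

Notation nu := (@endv G).
Notation io := (@twin G).
Notation F := [set: edge G * bool].

(* Positive edges are directed out of their [true] end, negative edges are
   extroverted. *)
Definition ref_orient h : bool := h.2 || negative h.1.

Lemma wf_all : wf io F.
Proof. by move=> h _; have [|_ n1 k1] := @wf_halfedges G setT h; rewrite ?inE. Qed.

Lemma halfedges_all : halfedges [set: edge G] = F.
Proof. by apply/setP => h; rewrite !inE. Qed.

Lemma orientation_compat o : is_orientation o <-> compat io F o ref_orient.
Proof.
split=> [O [e b] _|C e].
  have := O e; rewrite /twin /ref_orient /=.
  by case: b; case: (negative e) => /= ->; case: (o _).
have := C (e, true) (in_setT _); rewrite /twin /ref_orient /=.
by case: (negative e); case: (o (e, true)); case: (o (e, false)).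
Qed.

Lemma is_flow_excess o (xi : edge G -> int) : is_flow o xi <->
  forall v, excess nu F (fun h => sg (o h) * xi h.1) v = 0.
Proof.
suff E v : excess nu F (fun h => sg (o h) * xi h.1) v =
    \sum_(h | (endv h == v) && o h) xi h.1 - \sum_(h | (endv h == v) && ~~ o h) xi h.1.
  by split=> Z v; have := Z v; rewrite E.
rewrite /excess (bigID o) /= -sumrN; congr (_ + _); apply: eq_big => h; rewrite ?inE //.
  by case/andP=> _ ->; rewrite mul1r.
by case/andP=> _ /negPf->; rewrite mulN1r.
Qed.

(** A positive edge contributes 1 - 1, a negative edge 1 + 1. *)
Lemma sum_ref_orient C : \sum_(h in halfedges C) sg (ref_orient h) =
  2 * #|[set e in C | negative e]|%:Z.
Proof.
rewrite sum_halfedges -[#|_|%:Z]natz -[_%:R]/(1 *+ _) -sumr_const mulr_sumr.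
rewrite big_mkcond [RHS]big_mkcond; apply: eq_bigr => e _; rewrite inE /ref_orient /=.
by case: (e \in C) => //=; case: (negative e).
Qed.

Lemma mod4_ref_orient C : (4 %| \sum_(h in halfedges C) sg (ref_orient h))%Z =
  ~~ odd #|[set e in C | negative e]|.
Proof. by rewrite sum_ref_orient; move: #|_| => n; lia. Qed.

Lemma compat_sub (S : {set edge G * bool}) g o : compat io F g o -> compat io S g o.
Proof. by move=> C h _; apply: C; rewrite inE. Qed.

Lemma connect_endv K x y (Y : {set vertex G}) : connect (adjacent K) x y ->
  (forall h, h \in halfedges (eset K) -> nu h \in Y -> nu (io h) \in Y) ->
  x \in Y -> y \in Y.
Proof.
move=> /connectP[s]; elim: s x => [x _ -> //|z s IH] x /= /andP[xz ps] yl cl xY.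
apply: (IH z) => //; case/existsP: xz => e /andP[eK /existsP[b /andP[/eqP ex1 /eqP <-]]].
by apply: (cl (e, b)); rewrite ?inE // ex1.
Qed.

Lemma conn_connected K : connected K -> connected_halves nu io (halfedges (eset K)).
Proof.
move=> [_ cK] Y cl [[e b] eK eY] [f c] fK.
rewrite !inE /= in eK fK; apply: connect_endv (cK _ _ _ _) cl eY; exact: endv_vset.
Qed.

Lemma even_deg_eulerian K : eulerian K -> even_deg nu (halfedges (eset K)).
Proof.
move=> [_ evK] v; rewrite -valencyE; have [/evK//|vK] := boolP (v \in vset K).
rewrite (_ : valency K v = 0%N) //; apply: eq_card0 => -[e b]; rewrite !inE /=.
by apply/andP => -[eK /eqP ev]; case/negP: vK; rewrite -ev; apply: endv_vset.
Qed.

Lemma exists_half_at K v : connected K -> v \in vset K -> eset K != set0 ->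
  exists2 h, h \in halfedges (eset K) & nu h = v.
Proof.
move=> [_ cK] vK /set0Pn[e eK].
have [[h hK hv]|none] := pselect (exists2 h, h \in halfedges (eset K) & nu h = v).
  by exists h.
have evK : endv (e, true) \in vset K by apply: endv_vset.
have : endv (e, true) \in [set v].
  apply: connect_endv (cK _ _ vK evK) _ _; rewrite ?inE // => h hK.
  by rewrite !inE => /eqP hv; case: none; exists h.
by rewrite inE => /eqP ev; exists (e, true); rewrite ?inE.
Qed.

Lemma odd_neg_neq0 C : odd #|[set e in C | negative e]| -> C != set0.
Proof.
apply: contraTneq => ->; rewrite (_ : [set e in set0 | _] = set0) ?cards0 //.
by apply/setP => e; rewrite !inE.
Qed.

Lemma kflow_of_half k g (xi : edge G * bool -> int) : compat io F g ref_orient ->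
  (forall h, xi (io h) = xi h /\ (xi h != 0 /\ `|xi h| < k%:Z)) ->
  (forall v, excess nu F (fun h => sg (g h) * xi h) v = 0) -> has_nz_kflow G k.
Proof.
move=> cg xi1 ex0; exists g, (fun e => xi (e, true)); split.
- exact/orientation_compat.
- apply/is_flow_excess => v; rewrite -(ex0 v); apply: eq_excess => -[e b] _ /=.
  by case: b => //; have [<- _] := xi1 (e, false).
by move=> e; have [_] := xi1 (e, true).
Qed.

Section Eulerian.
Hypothesis hG : eulerian (whole G).

Let connF : connected_halves nu io F.
Proof. by rewrite -halfedges_all; apply: (conn_connected (K := whole G)); case: hG. Qed.

Let evF : even_deg nu F.
Proof. by rewrite -halfedges_all; apply: (even_deg_eulerian hG). Qed.

Lemma mod4_all : (4 %| \sum_(h in F) sg (ref_orient h))%Z = ~~ odd (num_negative (whole G)).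
Proof. by rewrite -halfedges_all mod4_ref_orient. Qed.

(** The sum modulo 4 makes the excess vanish at the root of the Euler orientation too, and an
    orientation of excess 0 is a flow with all values 1. *)
Lemma kflow2_even : ~~ odd (num_negative (whole G)) -> has_nz_kflow G 2.
Proof.
rewrite -mod4_all => m4.
suff [g [cg exg]] : exists g, compat io F g ref_orient /\
    forall v, excess nu F (fun h => sg (g h)) v = 0.
  apply: (kflow_of_half (g := g) (xi := fun=> 1)) => // v.
  by rewrite -(exg v); apply: eq_excess => h _; rewrite mulr1.
have [E|[h0 h0F]] := set_0Vmem F.
  exists ref_orient; split; first by move=> h hF; rewrite !addbb.
  by move=> v; rewrite /excess E big1 // => h; rewrite inE.
have [g [cg ex0 [b1 [b2 exb]]]] := euler_orientation wf_all connF evF ref_orient h0F.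
exists g; split=> // w; have [->|/ex0//] := eqVneq w (nu h0).
have := compat_mod4 wf_all cg.
rewrite (sum_excess_all nu F (fun h => sg (g h))) (bigD1 (nu h0)) //= big1 => [|v /ex0//].
rewrite exb addr0; exact: sg_add_eq0 m4.
Qed.

(** Reversing the edges of value -1 leaves an orientation of excess 0, whose sum is 0. *)
Lemma even_kflow2 : has_nz_kflow G 2 -> ~~ odd (num_negative (whole G)).
Proof.
move=> [o [xi [/orientation_compat co /is_flow_excess exo xi1]]].
have xiE e : xi e = 1 \/ xi e = -1 by have [] := xi1 e; move: (xi e) => x; lia.
pose g h := o h (+) (xi h.1 == -1).
have cg : compat io F g ref_orient.
  apply: compat_trans co => h _; rewrite /g /=.
  by case: (o h); case: (o (io h)); case: (_ == _).
have gE h : sg (g h) = sg (o h) * xi h.1.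
  by rewrite /g; have [->|->] := xiE h.1; case: (o h).
have := compat_mod4 wf_all cg; rewrite (sum_excess_all nu F (fun h => sg (g h))) big1.
  by rewrite sub0r -mod4_all; move: (\sum_(h in F) _) => S; lia.
by move=> v _; rewrite -(exo v); apply: eq_excess.
Qed.

Lemma flow_number2 : flow_number G 2 <-> ~~ odd (num_negative (whole G)).
Proof. by split=> [[_ /even_kflow2]|/kflow2_even f2] //; split. Qed.

(** Switched by [s], the net outflows still add up to 0, while the two halves of every edge but that
    of [h0] cancel. What remains is twice the value of that edge, up to sign. *)
Lemma nb_no_flow s h0 : (forall h, h != h0 -> h != io h0 ->
    ref_orient h (+) s (nu h) != ref_orient (io h) (+) s (nu (io h))) ->
  ref_orient h0 (+) s (nu h0) = ref_orient (io h0) (+) s (nu (io h0)) ->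
  ~ has_nz_flow int G.
Proof.
move=> pos neg [o [xi [/orientation_compat co /is_flow_excess exo xi0]]].
pose f h := sg (s (nu h)) * (sg (o h) * xi h.1).
have S0 : \sum_h f h = 0.
  have -> : \sum_h f h = \sum_(h in F) f h by apply: eq_bigl => h; rewrite inE.
  rewrite (sum_excess_all nu) big1 // => v _.
  rewrite -[RHS](mulr0 (sg (s v))) -(exo v) -excessZ.
  by apply: eq_bigr => h /andP[_ /eqP <-].
have io0 : io h0 != h0 := io_neq wf_all (in_setT h0).
have ioK' h : io (io h) = h := ioK wf_all (in_setT h).
have fio h : h != h0 -> h != io h0 -> f (io h) = - f h.
  move=> h1 h2; have := pos h h1 h2; have := co h (in_setT _); rewrite /f /=.
  case: (o h); case: (o (io h)); case: (ref_orient h); case: (ref_orient (io h));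
  by case: (s (nu h)); case: (s _) => //= _ _; rewrite /sg; ring.
have f0 : f (io h0) = f h0.
  have := neg; have := co h0 (in_setT _); rewrite /f /=.
  case: (o h0); case: (o (io h0)); case: (ref_orient h0); case: (ref_orient (io h0));
  by case: (s (nu h0)); case: (s _) => //= _ _; rewrite /sg; ring.
move: S0; rewrite (bigD1 h0) //= (bigD1 (io h0)) //=.
set S := \sum_(h | _) _; have SN : S = - S.
  rewrite {1}/S -sumrN (reindex_onto io io) /=; last by move=> h _; apply: ioK'.
  have cond h : (io h != h0) && (io h != io h0) && (io (io h) == h) =
      (h != h0) && (h != io h0).
    by rewrite ioK' eqxx andbT (can2_eq ioK' ioK') (can_eq ioK') andbC.
  apply: eq_big => h; rewrite cond // => /andP[h1 h2].
  exact: fio.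
rewrite f0; have := xi0 h0.1; rewrite /f; move: SN; move: (S) (xi h0.1) => a x.
by case: (s _); case: (o _); rewrite /sg; lia.
Qed.

(** Were the exceptional edge positive as well, the switched sum would vanish and the number of
    negative edges would be even. *)
Lemma near_balanced_no_flow : odd (num_negative (whole G)) ->
  near_balanced nu io F ref_orient -> ~ has_nz_flow int G.
Proof.
move=> oddG [s [h0 [_ pos]]].
apply: (nb_no_flow (s := s) (h0 := h0)) => [h h1 h2|]; first by apply: pos; rewrite ?inE.
apply/eqP; apply: contraT => pos0.
have posA h : ref_orient h (+) s (nu h) != ref_orient (io h) (+) s (nu (io h)).
  have [->//|h1] := eqVneq h h0; have [->|h2] := eqVneq h (io h0).
    by rewrite eq_sym (ioK wf_all) // in pos0 *.
  by apply: pos; rewrite ?inE.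
have : (4 %| \sum_(h in F) sg (ref_orient h))%Z; last by rewrite mod4_all oddG.
have := @sum_part_mod4 _ _ nu F [set: vertex G] s ref_orient evF.
have -> : side nu F [set: vertex G] = F by apply/setP => h; rewrite !inE.
apply; set t := fun h => sg (ref_orient h == s (nu h)).
have : \sum_(h in F | nu h \in [set: vertex G]) t h = - \sum_(h in F | nu h \in [set: vertex G]) t h.
  rewrite {1}(sum_io wf_all) -sumrN; apply: eq_big => [h|h _]; first by rewrite !inE.
  have := posA h; rewrite /t.
  by case: (ref_orient h); case: (ref_orient _); case: (s _); case: (s _).
by move: (\sum_(h in F | _) _) => S; lia.
Qed.

Lemma positive_onE s e (b : bool) : positive_on s e =
  (ref_orient (e, b) (+) s (nu (e, b)) != ref_orient (io (e, b)) (+) s (nu (io (e, b)))).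
Proof.
rewrite /positive_on /ref_orient /twin /=.
by case: b => /=; case: (negative e); case: (s _); case: (s _).
Qed.

Lemma four_flow_or_near : odd (num_negative (whole G)) ->
  near_balanced nu io F ref_orient \/ has_nz_kflow G 4.
Proof.
move=> oddG; have odd4 : ~~ (4 %| \sum_(h in F) sg (ref_orient h))%Z by rewrite mod4_all oddG.
have [nb|[xi [xi1 xi2]]] := near_balanced_or_4flow wf_all connF evF odd4; first by left.
right; apply: (kflow_of_half (g := ref_orient) (xi := xi)) => //.
  by move=> h hF; rewrite !addbb.
move=> h; have [-> /andP[b1 b3]] := xi1 h (in_setT _); split=> //.
split; first by rewrite -normr_gt0 (lt_le_trans _ b1).
exact: le_lt_trans b3 _.
Qed.

Lemma kflow_flow k : has_nz_kflow G k -> has_nz_flow int G.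
Proof. by move=> [o [xi [co fo xi1]]]; exists o, xi; split=> // e; have [] := xi1 e. Qed.

(** Without a flow the number of negative edges is odd, which rules out balance: a potential for [G]
    would make that number even. Conversely, a potential for [G] minus [e] fails at [e], since [G]
    would otherwise be balanced. *)
Lemma no_flowP : ~ has_nz_flow int G <->
  (~ balanced (whole G) /\ exists e : edge G, balanced (delete_edge e)).
Proof.
split=> [nf|[nbal [e bal]]].
  have oddG : odd (num_negative (whole G)).
    by apply: contraT => /kflow2_even /kflow_flow.
  have [[s [h0 [_ pos]]]|/kflow_flow//] := four_flow_or_near oddG; split.
    move=> bal; have [s' sb'] := balanced_potential (K := whole G) erefl bal.
    move: oddG; rewrite /num_negative odd_card_neg (odd_neg_potential sb') big1 // => w _.
    by rewrite -oddnessE halfedges_all (negPf (evF w)) andbF.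
  exists h0.1; apply: (@potential_balanced _ s) => f; rewrite !inE => fh.
  rewrite (positive_onE s f true); apply: pos; rewrite ?inE //.
    by apply: contraNneq fh => <-.
  by apply: contraNneq fh => /(congr1 fst) /= ->.
have [s sb] := balanced_potential (K := delete_edge e) erefl bal.
have [se|se] := boolP (positive_on s e).
  case: nbal; apply: (@potential_balanced _ s) => f _.
  have [->//|fe] := eqVneq f e; by apply: sb; rewrite !inE.
apply: (nb_no_flow (s := s) (h0 := (e, true))) => [[f b] h1 h2|].
  rewrite -positive_onE; apply: sb; rewrite !inE /=.
  apply: contraNneq h1 => fe; move: h2; rewrite fe /twin /= !xpair_eqE eqxx /=.
  by case: b.
by move: se; rewrite (positive_onE s e true) negbK => /eqP.
Qed.

Lemma decomposition_kflow3 : odd (num_negative (whole G)) -> has_nz_kflow G 3 ->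
  three_odd_eulerian_decomposition G.
Proof.
move=> oddG [o [xi [/orientation_compat co /is_flow_excess exo xi1]]].
have xiE e : [\/ xi e = 1, xi e = -1, xi e = 2 | xi e = -2].
  have [] := xi1 e; move: (xi e) => x x0 x3.
  have : x = 1 \/ x = -1 \/ x = 2 \/ x = -2 by lia.
  by case=> [|[|[|]]]; [constructor 1|constructor 2|constructor 3|constructor 4].
(* Modulo 3 a value [2] is [-1]: the edges of value [+-2] are reversed. *)
pose c e := (xi e == -1) || (xi e == 2).
pose two e := (`|xi e| == 2).
pose g h := o h (+) c h.1.
have cg : compat io F g ref_orient.
  apply: compat_trans co => h _; rewrite /g /=.
  by case: (o h); case: (o (io h)); case: (c _).
have gE h : sg (g h) = sg (o h) * xi h.1 + 3 * (sg (g h) * (two h.1)%:Z).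
  by rewrite /g /c /two; have [->|->|->|->] := xiE h.1; case: (o h).
(* Divisibility by 3 comes from the flow, divisibility by 2 from the even valencies. *)
have ex6 v : (6 %| excess nu F (fun h => sg (g h)) v)%Z.
  have [k Ek] := excess_even g v evF.
  have : excess nu F (fun h => sg (g h)) v = 3 * excess nu F (fun h => sg (g h) * (two h.1)%:Z) v.
    by rewrite -excessZ -[RHS]add0r -(exo v) -excessD; apply: eq_excess => h _; apply: gE.
  by rewrite Ek; move: (excess _ _ _ _) => x; lia.
have odd4 : ~~ (4 %| \sum_(h in F) sg (g h))%Z.
  have := compat_mod4 wf_all cg; have := mod4_all; rewrite oddG.
  by move: (\sum_(h in F) _) (\sum_(h in F) sg (g h)) => p q; lia.
have [v [g' [cg' exg']]] := excess6_exists wf_all connF ex6 odd4.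
have [S [[oS dS] US]] := three_odd_parts wf_all connF exg'.
pose E i := [set e | (e, true) \in S i].
have SE i : S i = halfedges (E i).
  have [_ wfS _ _ _] := oS i; apply/setP => -[e b]; rewrite !inE /=; case: b => //.
  by apply/idP/idP => [/(io_in wfS)|/(io_in wfS)].
have c0 : compat io F g' ref_orient := compat_trans cg' cg.
exists (fun i => edge_subgraph (E i)); split.
- move=> i; have [_ wfS cS [h0 h0S h0v] exS] := oS i; split.
    split; last first.
      move=> w _; rewrite valencyE /= -SE.
      apply: (@even_deg_excess _ _ nu (S i) g') => u.
      by rewrite exS; case: eqP.
    split; first by apply/set0Pn; exists v; apply/touchedP; exists h0; rewrite -?SE.
    move=> x y xs ys; pose Y := [set w | connect (adjacent (edge_subgraph (E i))) x w].
    have clY h : h \in S i -> nu h \in Y -> nu (io h) \in Y.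
      case: h => e b hS; rewrite !inE => xh; apply: connect_trans xh _; apply: connect1.
      have eE : e \in E i by move: hS; rewrite SE inE.
      apply/existsP; exists e; rewrite /= eE; apply/existsP; exists b.
      by rewrite !eqxx.
    case/touchedP: xs => hx hxS hxE; case/touchedP: ys => hy hyS <-.
    have : nu hy \in Y; last by rewrite inE.
    apply: (cS Y clY); last by rewrite SE.
    by exists hx; rewrite ?SE // inE hxE connect0.
  (* The excesses of the part add up to 2, so its number of negative edges is odd. *)
  have := compat_mod4 wfS (compat_sub c0 (S := S i)).
  rewrite (sum_excess_all nu (S i) (fun h => sg (g' h))) (eq_bigr _ (fun w _ => exS w)).
  rewrite -big_mkcond big_pred1_eq /= SE => m4.
  have := mod4_ref_orient (E i); rewrite /num_negative /=; move: m4.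
  by move: (\sum_(h in _) _) (odd _) => p b; case: b => //; lia.
- move=> i j ij; rewrite -setI_eq0; apply/eqP/setP => e; rewrite !inE.
  by apply/andP => -[ei ej]; have := disjointFr (dS i j ij) ei; rewrite ej.
- apply/setP => e; rewrite [RHS]inE; have : (e, true) \in F by rewrite inE.
  by rewrite -US => /bigcupP[i _ eS]; apply/bigcupP; exists i => //=; rewrite inE.
exists v => i; have [_ _ _ [h0 h0S h0v] _] := oS i.
by apply/touchedP; exists h0; rewrite -?SE.
Qed.

(** Each part has an orientation with excess 2 at [v] and 0 elsewhere; the multiples 1, 1 and -2 of
    the three cancel. *)
Lemma kflow3_decomposition : three_odd_eulerian_decomposition G ->
  odd (num_negative (whole G)) /\ has_nz_kflow G 3.
Proof.
move=> [K [eK dK UK [v vK]]].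
pose S i := halfedges (eset (K i)).
have dS i j : i != j -> [disjoint S i & S j].
  move=> ij; rewrite -setI_eq0; apply/eqP/setP => h; rewrite !inE.
  by apply/andP => -[hi hj]; have := disjointFr (dK i j ij) hi; rewrite hj.
have US : \bigcup_i S i = F.
  apply/setP => h; rewrite [RHS]inE; have : h.1 \in [set: edge G] by rewrite inE.
  by rewrite -UK => /bigcupP[i _ hi]; apply/bigcupP; exists i; rewrite ?inE.
have sumF (f : edge G * bool -> int) : \sum_(h in F) f h = \sum_i \sum_(h in S i) f h.
  rewrite (sum_excess_all nu); under eq_bigr => w _ do rewrite -US (excess_three nu _ _ dS).
  by rewrite exchange_big; apply: eq_bigr => i _; rewrite (sum_excess_all nu).
have oddS i : ~~ (4 %| \sum_(h in S i) sg (ref_orient h))%Z.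
  by have [_ oi] := eK i; rewrite mod4_ref_orient negbK.
split.
  have : (4 %| \sum_(h in F) sg (ref_orient h))%Z = false.
    rewrite sumF !big_ord_recl big_ord0.
    have := oddS ord0; have := oddS (lift ord0 ord0); have := oddS (lift ord0 (lift ord0 ord0)).
    rewrite !sum_ref_orient; move: #|_| #|_| #|_| => p q r; lia.
  by rewrite mod4_all => /negbFE.
have exg i : exists g, compat io (S i) g ref_orient /\
    forall w, excess nu (S i) (fun h => sg (g h)) w = if w == v then 2 else 0.
  have [eKi oKi] := eK i.
  have [h0 h0S h0v] := exists_half_at eKi.1 (vK i) (odd_neg_neq0 oKi).
  have [g [cg exgi]] := euler_odd (@wf_halfedges G (eset (K i))) (conn_connected eKi.1)
    (even_deg_eulerian eKi) (oddS i) h0S.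
  by exists g; split=> // w; rewrite exgi h0v.
have [g gP] : exists g : 'I_3 -> edge G * bool -> bool, forall i,
    compat io (S i) (g i) ref_orient /\
    forall w, excess nu (S i) (fun h => sg (g i h)) w = if w == v then 2 else 0.
  by exists (fun i => projT1 (cid (exg i))) => i; case: (cid _).
pose c (i : 'I_3) : int := if i == ord_max then -2 else 1.
pose f h := \sum_i (h \in S i)%:Z * (c i * sg (g i h)).
have fE i h : h \in S i -> f h = c i * sg (g i h).
  move=> hi; rewrite /f (bigD1 i) //= hi mul1r big1 ?addr0 // => j ji.
  by rewrite (disjointFl (dS j i ji) hi) mul0r.
have part_of h : exists i, h \in S i.
  by have : h \in F by [rewrite inE]; rewrite -US => /bigcupP[i _ hi]; exists i.
apply: (kflow_of_half (g := ref_orient) (xi := fun h => sg (ref_orient h) * f h)).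
- by move=> h hF; rewrite !addbb.
- move=> h; have [i hi] := part_of h; have hi' := io_in (@wf_halfedges G _) hi.
  have [cg _] := gP i; split.
    rewrite (fE i) // (fE i) // mulrCA [RHS]mulrCA; congr (_ * _).
    by rewrite mulrC (compat_sg cg hi) mulrC.
  by rewrite (fE i) // /c; case: (i == _); case: (ref_orient h); case: (g i h).
move=> w; transitivity (excess nu F f w).
  by apply: eq_excess => h _; rewrite mulrA sgM mul1r.
rewrite -US (excess_three nu _ _ dS) (eq_bigr (fun i => c i * (if w == v then 2 else 0))).
  by rewrite !big_ord_recl big_ord0 /c /=; case: (w == v).
move=> i _; have [_ <-] := gP i; rewrite -excessZ; apply: eq_excess => h; exact: fE.
Qed.

Lemma flow_number3 : flow_number G 3 <-> three_odd_eulerian_decomposition G.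
Proof.
split=> [[_ f3 min3]|/kflow3_decomposition[oddG f3]].
  apply: decomposition_kflow3 f3; apply: contraT => /kflow2_even f2.
  by have := min3 2 isT f2.
split=> // j; rewrite leq_eqVlt => /orP[/eqP<-|//].
by move/even_kflow2; rewrite oddG.
Qed.

Lemma flow_number4 : has_nz_flow int G -> odd (num_negative (whole G)) ->
  ~ three_odd_eulerian_decomposition G -> flow_number G 4.
Proof.
move=> hf oddG ndec; have [nb|f4] := four_flow_or_near oddG.
  by case: (near_balanced_no_flow oddG nb).
split=> // j; rewrite leq_eqVlt => /orP[/eqP<- /even_kflow2|]; first by rewrite oddG.
rewrite leq_eqVlt => /orP[/eqP<- f3|//].
by case: ndec; apply: decomposition_kflow3.
Qed.

End Eulerian.
End Flows.

Local Close Scope ring_scope.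

Theorem mainTheorem1 (G : sgraph) (hG : eulerian (whole G)) :
  [/\ ~ has_nz_flow int G <->
        (~ balanced (whole G) /\ exists e : edge G, balanced (delete_edge e)),
      flow_number G 2 <-> ~~ odd (num_negative (whole G)),
      flow_number G 3 <-> three_odd_eulerian_decomposition G
    & has_nz_flow int G ->
      odd (num_negative (whole G)) ->
      ~ three_odd_eulerian_decomposition G ->
      flow_number G 4].
Proof.
split; [exact: no_flowP | exact: flow_number2 | exact: flow_number3 | exact: flow_number4].
Qed.
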